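(* Let $(X,d)$ be a locally compact, geodesically complete CAT(0)-space connected at infinity, and let $d'$ be a metric on $X$ such that $(X,d')$ is a locally compact geodesically complete CAT(0)-space and $d(x,y)\le1\iff d'(x,y)\le1$ for all $x,y\in X$. Let $a\colon(-\infty,+\infty)\to X$ be a complete geodesic of strictly rank one with respect to $d$. Then $a$ is of strictly rank one with respect to $d'$ as well, and $d'(a(t_1),a(t_2))=d(a(t_1),a(t_2))$ for all $t_1,t_2\in\mathbb R$.
   Context: A complete geodesic has strictly rank one (with respect to a given metric) if there is no finite sequence of complete geodesics starting with it, with consecutive ones asymptotic (containing rays at finite Hausdorff distance), ending with a boundary line of a subset isometric to a Euclidean strip $\mathbb R\times[0,w]$, $w>0$. Geodesically complete: geodesic and every geodesic segment lies in a complete geodesic; connected at infinity: complement of every metric ball path connected. *)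

(* Defs.v *)
(* concrete real numbers R.  A metric space is a type X
   together with a distance function d : X -> X -> R satisfying the metric
   axioms; all notions below are relative to the given metric d, since the
   theorem compares two metrics on the same set. *)
From Stdlib Require Import Reals List.
Open Scope R_scope.
Set Implicit Arguments.

Section Metric.
Variable X : Type.
Variable d : X -> X -> R.

Definition is_metric : Prop :=
  (forall x y, 0 <= d x y) /\
  (forall x y, d x y = 0 <-> x = y) /\
  (forall x y, d x y = d y x) /\
  (forall x y z, d x z <= d x y + d y z).

Definition ball (x : X) (r : R) : X -> Prop := fun y => d x y < r.

Definition open_set (U : X -> Prop) : Prop :=
  forall x, U x -> exists e, 0 < e /\ forall y, ball x e y -> U y.

Definition compact_set (K : X -> Prop) : Prop :=
  forall (Fam : (X -> Prop) -> Prop),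
    (forall U, Fam U -> open_set U) ->
    (forall x, K x -> exists U, Fam U /\ U x) ->
    exists l : list (X -> Prop),
      (forall U, In U l -> Fam U) /\
      (forall x, K x -> exists U, In U l /\ U x).

Definition locally_compact : Prop :=
  forall x, exists K, compact_set K /\
    exists r, 0 < r /\ forall y, ball x r y -> K y.

Definition isometric_on (c : R -> X) (s0 s1 : R) : Prop :=
  forall s t, s0 <= s <= s1 -> s0 <= t <= s1 -> d (c s) (c t) = Rabs (s - t).

Definition complete_geodesic (c : R -> X) : Prop :=
  forall s t, d (c s) (c t) = Rabs (s - t).

Definition geodesic_from_to (c : R -> X) (x y : X) : Prop :=
  c 0 = x /\ c (d x y) = y /\ isometric_on c 0 (d x y).

Definition geodesic_space : Prop :=
  forall x y, exists c, geodesic_from_to c x y.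

(* CAT(0): geodesic, and for every geodesic triangle the distance between
   any two points is at most the distance of their comparison points in the
   Euclidean comparison triangle.  Any two points on a triangle lie on two
   sides issuing from a common vertex x (or on a single side, where equality
   is trivial); with side lengths a = d x y, b = d x z, c = d y z and points at
   distance s (resp. t) from x on the sides [x,y] (resp. [x,z]), the squared
   comparison distance is s^2 + t^2 - 2 s t cos(gamma), with
   cos(gamma) = (a^2 + b^2 - c^2) / (2 a b) (law of cosines). *)
Definition CAT0 : Prop :=
  geodesic_space /\
  forall x y z c1 c2,
    geodesic_from_to c1 x y -> geodesic_from_to c2 x z ->
    forall s t, 0 <= s <= d x y -> 0 <= t <= d x z ->
      (d (c1 s) (c2 t))^2 <=
        s^2 + t^2 - s * t * ((d x y)^2 + (d x z)^2 - (d y z)^2) / (d x y * d x z).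

Definition geodesically_complete : Prop :=
  geodesic_space /\
  forall (c : R -> X) (s0 s1 : R), s0 < s1 -> isometric_on c s0 s1 ->
    exists g, complete_geodesic g /\ forall t, s0 <= t <= s1 -> g t = c t.

Definition path_in (S : X -> Prop) (p : R -> X) : Prop :=
  (forall u, 0 <= u <= 1 -> S (p u)) /\
  (forall u, 0 <= u <= 1 -> forall e, 0 < e -> exists del, 0 < del /\
     forall v, 0 <= v <= 1 -> Rabs (v - u) < del -> d (p u) (p v) < e).

Definition path_connected (S : X -> Prop) : Prop :=
  forall x y, S x -> S y -> exists p, path_in S p /\ p 0 = x /\ p 1 = y.

Definition connected_at_infinity : Prop :=
  forall x r, path_connected (fun y => ~ ball x r y).

Definition ray_of (c : R -> X) (R0 : X -> Prop) : Prop :=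
  exists t0,
    (forall p, R0 p <-> exists t, t0 <= t /\ p = c t) \/
    (forall p, R0 p <-> exists t, t <= t0 /\ p = c t).

Definition finite_hausdorff (A B : X -> Prop) : Prop :=
  exists C, (forall p, A p -> exists q, B q /\ d p q <= C) /\
            (forall q, B q -> exists p, A p /\ d p q <= C).

Definition asymptotic (c1 c2 : R -> X) : Prop :=
  exists R1 R2, ray_of c1 R1 /\ ray_of c2 R2 /\ finite_hausdorff R1 R2.

Inductive asym_chain : (R -> X) -> (R -> X) -> Prop :=
| chain_refl c : complete_geodesic c -> asym_chain c c
| chain_step c1 c2 c3 : complete_geodesic c1 -> asymptotic c1 c2 ->
    asym_chain c2 c3 -> asym_chain c1 c3.

Definition boundary_line_of_strip (b : R -> X) : Prop :=
  exists (w : R) (F : R -> R -> X), 0 < w /\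
    (forall x1 y1 x2 y2, 0 <= y1 <= w -> 0 <= y2 <= w ->
       d (F x1 y1) (F x2 y2) = sqrt ((x1 - x2)^2 + (y1 - y2)^2)) /\
    ((forall p, (exists t, p = b t) <-> (exists s, p = F s 0)) \/
     (forall p, (exists t, p = b t) <-> (exists s, p = F s w))).

Definition strictly_rank_one (a : R -> X) : Prop :=
  complete_geodesic a /\
  ~ (exists b, asym_chain a b /\ boundary_line_of_strip b).

End Metric.

(* Main.v *)
(* Since geodesics are chains of unit steps, [d] and [d'] agree on which distances are less
   than, or equal to, a natural number, and they define the same topology. Hence a [d]-line
   [b] satisfies [d' (b s) (b (s + n)) = n], and in [d'] the sequences [b (s + n)] for
   different [s] are parallel; their offsets define an increasing homeomorphism [psi b] of
   the real line, commuting with the unit translation, which carries Busemann functions of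
   [b] for [d] to those for [d']. So flat points (those at which the two Busemann functions of
   [b] are opposite) are the same for both metrics; they span flat strips, and for a line
   without flat strips [d' (b s) (b t) = |psi b s - psi b t|]. It remains to show that
   [psi a] is the identity.

   If the negative end of [b] and the positive end of [c] are at finite distance at infinity,
   then [psi b] and [psi c] differ by translations. Closed chains of such pairs produce
   periods of [psi a]; arbitrarily small periods make it the identity. If there are none,
   lines linked to [a] bound no strips (an oblique segment in a strip gives small periods), and
   a continuity argument shows that near [b (-T)], for every linked line [b], all geodesics
   to [b 0] pass on to [b [0, oo)]. As the space is separable, there are then only countably
   many points at a given distance from [a 0] near [a (-T)], so that [a (-T)] separates
   its neighbourhood, contrary to connectedness at infinity.

   The hypotheses do not make the space complete, hence not proper: limits of
   geodesic lines and rays to points at infinity need not exist and are avoided; separability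
   and the uncountability of the real line replace compactness. *)
Require Import Defs.
From Stdlib Require Import Reals.
From Stdlib Require Import ZArith Ranalysis5 List Lra Lia Classical ClassicalEpsilon.
From Stdlib Require Import FunctionalExtensionality Cantor.
Open Scope R_scope.

(** * Elementary facts on real numbers *)

Lemma Rsqr_le_cancel (a b : R) : 0 <= b -> a^2 <= b^2 -> a <= b.
Proof. intros; nra. Qed.

Lemma nat_above (x : R) : exists n : nat, x < INR n.
Proof.
destruct (archimed (Rabs x)) as [H _].
exists (Z.to_nat (up (Rabs x))).
pose proof (Rabs_pos x).
assert (0 <= up (Rabs x))%Z by (apply le_IZR; lra).
rewrite INR_IZR_INZ, Z2Nat.id by assumption.
pose proof (Rle_abs x); lra.
Qed.

Lemma inv_nat_below (e : R) : 0 < e -> exists k : nat, / INR (S k) < e.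
Proof.
intros He. destruct (nat_above (/ e)) as [k Hk]. exists k.
rewrite <- (Rinv_inv e). apply Rinv_lt_contravar.
- apply Rmult_lt_0_compat; [now apply Rinv_0_lt_compat | apply lt_0_INR; lia].
- rewrite S_INR; lra.
Qed.

Lemma Rle_add_eps (a b : R) : (forall e, 0 < e -> a < b + e) -> a <= b.
Proof.
intros H. destruct (Rle_lt_dec a b) as [|C]; [assumption|].
specialize (H (a - b)); lra.
Qed.

(** * Infima of sequences *)

Definition is_inf (f : nat -> R) (l : R) : Prop :=
  (forall n, l <= f n) /\ (forall e, 0 < e -> exists n, f n < l + e).

(** Total by choice; the value is meaningful only for sequences bounded below. *)
Definition infn (f : nat -> R) : R := epsilon (inhabits 0) (is_inf f).

Definition decr (f : nat -> R) : Prop := forall n, f (S n) <= f n.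

Lemma infn_spec (f : nat -> R) (M : R) :
  (forall n, M <= f n) -> is_inf f (infn f).
Proof.
intros HM. unfold infn. apply epsilon_spec.
destruct (completeness (fun x => exists n, x = - f n)) as [l [Hl1 Hl2]].
- exists (- M). intros x [n ->]. specialize (HM n); lra.
- exists (- f O). now exists O.
- exists (- l). split.
  + intros n. assert (- f n <= l) by (apply Hl1; now exists n). lra.
  + intros e He. apply NNPP. intros C.
    assert (l <= l - e); [|lra].
    apply Hl2. intros x [n ->].
    destruct (Rlt_le_dec (f n) (- l + e)) as [h|h]; [|lra].
    exfalso; apply C; now exists n.
Qed.

Lemma decr_le (f : nat -> R) (n k : nat) : decr f -> (n <= k)%nat -> f k <= f n.
Proof.
intros Hf; induction 1 as [|k Hk IH]; [lra|].
specialize (Hf k); lra.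
Qed.

Lemma is_inf_eventually (f : nat -> R) (l e : R) :
  decr f -> is_inf f l -> 0 < e ->
  exists N, forall n, (N <= n)%nat -> f n < l + e.
Proof.
intros Hf [_ H] He. destruct (H e He) as [N HN].
exists N. intros n Hn. pose proof (decr_le f N n Hf Hn). lra.
Qed.

(** Late terms of the decreasing [g] approximate its infimum, so inequalities between late terms
    suffice, even with the index of [f] moved by [j]. Most relations between Busemann functions
    below come from this. *)
Lemma is_inf_le_shift (f g : nat -> R) (a b c : R) (N j : nat) :
  is_inf f a -> decr g -> is_inf g b ->
  (forall n, (N <= n)%nat -> f (n + j)%nat <= g n + c) -> a <= b + c.
Proof.
intros Ha Dg Hb H. apply Rle_add_eps. intros e He.
destruct (is_inf_eventually g b e Dg Hb He) as [M HM].
pose proof (H (N + M)%nat ltac:(lia)). pose proof (HM (N + M)%nat ltac:(lia)).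
pose proof (proj1 Ha (N + M + j)%nat). lra.
Qed.

Lemma is_inf_unique (f : nat -> R) (a b : R) : is_inf f a -> is_inf f b -> a = b.
Proof.
intros [Ha1 Ha2] [Hb1 Hb2]. apply Rle_antisym; apply Rle_add_eps; intros e He.
- destruct (Hb2 e He) as [n Hn]. specialize (Ha1 n); lra.
- destruct (Ha2 e He) as [n Hn]. specialize (Hb1 n); lra.
Qed.

(** * CAT(0) inequalities *)

Section CAT.
Variables (X : Type) (d : X -> X -> R).
Hypotheses (Hm : is_metric d) (Hc : CAT0 d).

Lemma metric_pos x y : 0 <= d x y.
Proof. apply Hm. Qed.
Lemma metric_refl x : d x x = 0.
Proof. now apply Hm. Qed.
Lemma metric_eq x y : d x y = 0 -> x = y.
Proof. apply Hm. Qed.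
Lemma metric_sym x y : d x y = d y x.
Proof. apply Hm. Qed.
Lemma metric_tri y x z : d x z <= d x y + d y z.
Proof. apply Hm. Qed.
Lemma metric_lip x y z : Rabs (d x z - d y z) <= d x y.
Proof.
pose proof (metric_tri y x z). pose proof (metric_tri x y z).
pose proof (metric_sym x y). apply Rabs_le; lra.
Qed.

(* [m] divides a segment from [x] to [y] in the ratio [l : 1 - l]. *)
Definition btw (x y : X) (l : R) (m : X) : Prop :=
  d x m = l * d x y /\ d m y = (1 - l) * d x y.

(** Stewart's relation in the comparison triangle, from the CAT(0) inequality with the second point
    at the end [p] of its side. The factor [d x y] avoids division in degenerate triangles. *)
Lemma geodesic_comparison c x y t p :
  geodesic_from_to d c x y -> 0 <= t <= d x y ->
  d x y * d p (c t) ^ 2 <=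
  (d x y - t) * d p x ^ 2 + t * d p y ^ 2 - t * (d x y - t) * d x y.
Proof.
intros Hg Ht. destruct Hc as [Hgs Hineq].
destruct (Hgs x p) as [c2 Hc2].
assert (Hb : 0 <= d x p <= d x p) by (pose proof (metric_pos x p); lra).
pose proof (Hineq x y p c c2 Hg Hc2 t (d x p) Ht Hb) as H.
destruct Hc2 as (_ & E & _). rewrite E in H.
rewrite (metric_sym p (c t)), (metric_sym p x), (metric_sym p y).
destruct (Req_dec (d x y) 0) as [Z|Z].
{ rewrite Z in *. replace t with 0 by lra. lra. }
destruct (Req_dec (d x p) 0) as [Z2|Z2].
{ apply metric_eq in Z2. subst p.
  destruct Hg as (E0 & _ & Hiso).
  assert (Ec : d (c t) x = t).
  { rewrite <- E0, Hiso by lra. rewrite Rminus_0_r. apply Rabs_right; lra. }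
  rewrite Ec, metric_refl, (metric_sym y x). nra. }
assert (0 < d x y) by (pose proof (metric_pos x y); lra).
apply Rmult_le_compat_l with (r := d x y) in H; [|lra].
eapply Rle_trans; [exact H|]. apply Req_le. field; split; assumption.
Qed.

Lemma btw_exists x y l : 0 <= l <= 1 -> exists m, btw x y l m.
Proof.
intros Hl. destruct (proj1 Hc x y) as [c (E0 & E1 & Hiso)].
exists (c (l * d x y)). pose proof (metric_pos x y).
assert (0 <= l * d x y <= d x y) by nra.
pose proof (Hiso 0 (l * d x y) ltac:(lra) ltac:(lra)) as F0.
pose proof (Hiso (l * d x y) (d x y) ltac:(lra) ltac:(lra)) as F1.
rewrite E0 in F0. rewrite E1 in F1.
rewrite <- Rabs_Ropp, Rabs_right in F0, F1 by lra.
split; lra.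
Qed.

(** [btw] records only two distances. Comparison applied to [m] itself identifies [m] with a point
    of a chosen geodesic, for which the inequality is known. *)
Lemma btw_comparison x y l m p : 0 <= l <= 1 -> btw x y l m ->
  d p m ^ 2 <= (1 - l) * d p x ^ 2 + l * d p y ^ 2 - l * (1 - l) * d x y ^ 2.
Proof.
intros Hl [H1 H2].
destruct (Req_dec (d x y) 0) as [Z|Z].
{ rewrite Z in *. rewrite Rmult_0_r in *. apply metric_eq in H1, H2. subst. lra. }
pose proof (metric_pos x y).
destruct (proj1 Hc x y) as [c Hg].
assert (Ht : 0 <= l * d x y <= d x y) by nra.
assert (K : forall p, d p (c (l * d x y)) ^ 2 <=
  (1 - l) * d p x ^ 2 + l * d p y ^ 2 - l * (1 - l) * d x y ^ 2).
{ intros p'. pose proof (geodesic_comparison c x y _ p' Hg Ht) as H0.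
  apply Rmult_le_reg_l with (d x y); [lra|].
  eapply Rle_trans; [exact H0|]. apply Req_le. ring. }
assert (E : m = c (l * d x y)).
{ apply metric_eq. specialize (K m). rewrite (metric_sym m x), H1, H2 in K.
  pose proof (metric_pos m (c (l * d x y))). nra. }
rewrite E. apply K.
Qed.

Lemma btw_sym x y l m : btw x y l m -> btw y x (1 - l) m.
Proof.
intros [H1 H2]. split; rewrite (metric_sym y x).
- now rewrite (metric_sym y m).
- rewrite (metric_sym m x), H1. ring.
Qed.

Lemma btw_const x l : btw x x l x.
Proof. split; rewrite metric_refl; ring. Qed.

(** Two applications of the comparison: [n] seen from [m], then [m] seen from [z]. *)
Lemma btw_two_sides x y z l k m n : 0 <= l <= 1 -> 0 <= k <= 1 ->
  btw x y l m -> btw x z k n ->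
  d m n ^ 2 <= l * (l - k) * d x y ^ 2 + k * (k - l) * d x z ^ 2
               + l * k * d y z ^ 2.
Proof.
intros Hl Hk Bm Bn.
pose proof (btw_comparison x z k n m Hk Bn) as K1.
pose proof (btw_comparison x y l m z Hl Bm) as K2.
rewrite (metric_sym m x), (proj1 Bm), (metric_sym m z) in K1.
rewrite (metric_sym z x), (metric_sym z y) in K2.
nra.
Qed.

Lemma btw_thales x y z l m n : 0 <= l <= 1 ->
  btw x y l m -> btw x z l n -> d m n <= l * d y z.
Proof.
intros Hl Bm Bn. pose proof (btw_two_sides x y z l l m n Hl Hl Bm Bn) as K.
pose proof (metric_pos y z). apply Rsqr_le_cancel; nra.
Qed.

(** The diagonal from [x] to [y'] cuts the quadrilateral into two triangles, each contributing one
    term. *)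
Lemma btw_convex x y x' y' l m m' : 0 <= l <= 1 ->
  btw x y l m -> btw x' y' l m' -> d m m' <= (1 - l) * d x x' + l * d y y'.
Proof.
intros Hl Bm Bm'. destruct (btw_exists x y' l Hl) as [n Bn].
pose proof (btw_thales x y y' l m n Hl Bm Bn).
pose proof (btw_thales y' x x' (1 - l) n m' ltac:(lra)
  (btw_sym _ _ _ _ Bn) (btw_sym _ _ _ _ Bm')).
pose proof (metric_tri n m m'). lra.
Qed.

Lemma btw_convex_point x y l m p : 0 <= l <= 1 -> btw x y l m ->
  d m p <= (1 - l) * d x p + l * d y p.
Proof. intros Hl B. exact (btw_convex x y p p l m p Hl B (btw_const p l)). Qed.

(** The midpoint of one diagonal is compared from both ends of the other. *)
Lemma quadrilateral_ineq x1 x2 x3 x4 :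
  d x1 x3 ^ 2 + d x2 x4 ^ 2 <=
  d x1 x2 ^ 2 + d x2 x3 ^ 2 + d x3 x4 ^ 2 + d x4 x1 ^ 2.
Proof.
destruct (btw_exists x1 x3 (1/2) ltac:(lra)) as [m Bm].
pose proof (btw_comparison x1 x3 (1/2) m x2 ltac:(lra) Bm) as K1.
pose proof (btw_comparison x1 x3 (1/2) m x4 ltac:(lra) Bm) as K2.
pose proof (metric_tri m x2 x4) as T. rewrite (metric_sym m x4) in T.
pose proof (metric_pos x2 x4). pose proof (metric_pos x2 m). pose proof (metric_pos x4 m).
rewrite (metric_sym x2 x1) in K1. rewrite (metric_sym x4 x3) in K2.
assert (d x2 x4 ^ 2 <= 2 * (d x2 m ^ 2 + d x4 m ^ 2)).
{ assert (d x2 x4 ^ 2 <= (d x2 m + d x4 m) ^ 2) by (apply pow_incr; lra).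
  pose proof (pow2_ge_0 (d x2 m - d x4 m)). lra. }
nra.
Qed.

End CAT.

(** * Prolongation of segments; cluster points in compact sets *)

Section Extension.
Variables (X : Type) (d : X -> X -> R).
Hypotheses (Hm : is_metric d) (Hgc : geodesically_complete d).

Lemma line_through x y : x <> y ->
  exists g, complete_geodesic d g /\ g 0 = x /\ g (d x y) = y.
Proof.
intros Hxy. destruct (proj1 Hgc x y) as [c (E0 & E1 & Hiso)].
assert (0 < d x y).
{ destruct (metric_pos X d Hm x y) as [|Z]; [assumption|].
  symmetry in Z. apply metric_eq in Z; [contradiction|exact Hm]. }
destruct (proj2 Hgc c 0 (d x y) ltac:(assumption) Hiso) as [g [Hg1 Hg2]].
exists g. split; [exact Hg1|].
rewrite !Hg2 by lra. now split.
Qed.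

Lemma segment_extension x y r : x <> y -> 0 <= r ->
  exists z, d x z = d x y + r /\ d y z = r.
Proof.
intros Hxy Hr. destruct (line_through x y Hxy) as [g (Hg & E0 & E1)].
exists (g (d x y + r)). pose proof (metric_pos X d Hm x y).
pose proof (Hg 0 (d x y + r)) as F0. pose proof (Hg (d x y) (d x y + r)) as F1.
rewrite E0 in F0. rewrite E1 in F1.
rewrite <- Rabs_Ropp, Rabs_right in F0, F1 by lra.
split; lra.
Qed.

End Extension.

(** Without a cluster point, the open sets that the sequence eventually leaves would cover [K], and
    the sequence would eventually leave a finite subcover, hence [K]. *)
Lemma compact_cluster (X : Type) (d : X -> X -> R) (K : X -> Prop) (z : nat -> X) :
  is_metric d -> compact_set d K -> (forall k, K (z k)) ->
  exists p, forall del N, 0 < del -> exists k, (N <= k)%nat /\ d p (z k) < del.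
Proof.
intros Hm HK Hz. apply NNPP. intros C.
destruct (HK (fun U => Defs.open_set d U /\ exists N, forall k, (N <= k)%nat -> ~ U (z k)))
  as [l [Hl1 Hl2]].
- tauto.
- intros p _.
  assert (exists del N, 0 < del /\ forall k, (N <= k)%nat -> del <= d p (z k))
    as (del & N & Hdel & HN).
  { apply NNPP. intros C2. apply C. exists p. intros del N Hdel.
    apply NNPP. intros C3. apply C2. exists del, N. split; [assumption|].
    intros k Hk. apply Rnot_lt_le. intros C4. apply C3. now exists k. }
  exists (ball d p del). split; [split|].
  + intros x Hx. unfold ball in *. exists (del - d p x). split; [lra|].
    intros y Hy. pose proof (metric_tri X d Hm x p y). lra.
  + exists N. intros k Hk. specialize (HN k Hk). unfold ball. lra.
  + unfold ball. now rewrite metric_refl.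
- assert (exists N, forall U, In U l -> forall k, (N <= k)%nat -> ~ U (z k)) as [N HN].
  { clear Hl2. induction l as [|U l IH].
    - exists O. intros ? [].
    - destruct IH as [N1 H1]. { intros V HV; apply Hl1; now right. }
      destruct (Hl1 U (or_introl eq_refl)) as [_ [N2 H2]].
      exists (Nat.max N1 N2). intros V [<-|HV] k Hk.
      + apply H2; lia.
      + apply (H1 V HV); lia. }
  destruct (Hl2 (z N) (Hz N)) as [U [HU1 HU2]].
  exact (HN U HU1 N (le_n N) HU2).
Qed.

(** * Two metrics with the same closed unit balls *)

Section SameTopology.
Variables (X : Type) (d d' : X -> X -> R).
Hypotheses (Hm : is_metric d) (Hc : CAT0 d) (Hlc : locally_compact d)
  (Hm' : is_metric d') (Hgc' : geodesically_complete d')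
  (H1 : forall x y, d x y <= 1 <-> d' x y <= 1).

(* Otherwise points [z k] at a fixed [d]-distance [e0] from [x], on segments
   towards points converging to [x] for [d'], would accumulate at some [z <> x];
   by convexity the unit [d']-ball of [z] would contain the open one of [x]. *)
Lemma topology_coarser x e : 0 < e ->
  exists del, 0 < del /\ forall y, d' x y < del -> d x y < e.
Proof.
intros He. apply NNPP. intros C.
assert (S : forall k : nat, exists y, d' x y < / INR (S k) /\ e <= d x y).
{ intros k. apply NNPP. intros C2. apply C. exists (/ INR (S k)). split.
  - apply Rinv_0_lt_compat, lt_0_INR; lia.
  - intros y Hy. apply Rnot_le_lt. intros C3. apply C2. now exists y. }
destruct (choice _ S) as [y Hy]. clear S C.
destruct (Hlc x) as [K [HK [r [Hr HrK]]]].
set (e0 := Rmin e r / 2).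
assert (He0 : 0 < e0 < r /\ e0 < e).
{ unfold e0. pose proof (Rmin_l e r). pose proof (Rmin_r e r).
  assert (0 < Rmin e r) by (apply Rmin_pos; assumption). lra. }
assert (S : forall k, exists z, btw X d x (y k) (e0 / d x (y k)) z).
{ intros k. apply btw_exists; try assumption. destruct (Hy k) as [_ Hk].
  split; [apply Rlt_le, Rdiv_lt_0_compat; lra|].
  apply Rmult_le_reg_r with (d x (y k)); [lra|]. unfold Rdiv.
  rewrite Rmult_assoc, Rinv_l; lra. }
destruct (choice _ S) as [z Hz]. clear S.
assert (Hxz : forall k, d x (z k) = e0).
{ intros k. destruct (Hy k) as [_ Hk]. rewrite (proj1 (Hz k)). field. lra. }
destruct (compact_cluster X d K z Hm HK) as [p Hp].
{ intros k. apply HrK. unfold ball. rewrite Hxz. lra. }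
assert (Hxp : d x p = e0).
{ apply Rle_antisym; apply Rle_add_eps; intros h Hh;
  destruct (Hp h O Hh) as [k [_ Hk]]; specialize (Hxz k).
  - pose proof (metric_tri X d Hm (z k) x p). rewrite (metric_sym X d Hm (z k) p) in *. lra.
  - pose proof (metric_tri X d Hm p x (z k)). lra. }
assert (Hpx : p <> x).
{ intros E. rewrite E, metric_refl in Hxp by assumption. lra. }
assert (Hball : forall w, d' x w < 1 -> d' p w <= 1).
{ intros w Hw. apply H1. apply Rle_add_eps. intros h Hh.
  destruct (inv_nat_below (1 - d' x w)) as [N HN]; [lra|].
  destruct (Hp h N Hh) as [k [Hk1 Hk2]].
  assert (A : d (y k) w <= 1).
  { apply H1. destruct (Hy k) as [Hyk _].
    assert (/ INR (S k) <= / INR (S N)).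
    { apply Rinv_le_contravar; [apply lt_0_INR; lia|apply le_INR; lia]. }
    pose proof (metric_tri X d' Hm' x (y k) w).
    rewrite (metric_sym X d' Hm' (y k) x) in *. lra. }
  assert (B : d x w <= 1) by (apply H1; lra).
  assert (L : 0 <= e0 / d x (y k) <= 1).
  { destruct (Hy k) as [_ Hyk].
    split; [apply Rlt_le, Rdiv_lt_0_compat; lra|].
    apply Rmult_le_reg_r with (d x (y k)); [lra|]. unfold Rdiv.
    rewrite Rmult_assoc, Rinv_l; lra. }
  pose proof (btw_convex_point X d Hm Hc _ _ _ _ w L (Hz k)).
  pose proof (metric_tri X d Hm (z k) p w). nra. }
pose proof (metric_pos X d' Hm' p x).
assert (0 < d' p x).
{ destruct H as [|Z]; [assumption|]. symmetry in Z.
  apply metric_eq in Z; [contradiction|exact Hm']. }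
(* Prolonging the segment from [p] beyond [x] by [1 - eta] gives [w] inside the open unit ball of
   [x], but at distance [d' p x + 1 - eta > 1] from [p]. *)
set (eta := Rmin (1 / 2) (d' p x / 2)).
assert (0 < eta /\ eta <= 1 / 2 /\ eta <= d' p x / 2).
{ unfold eta. split; [apply Rmin_pos; lra|]. split; [apply Rmin_l|apply Rmin_r]. }
destruct (segment_extension X d' Hm' Hgc' p x (1 - eta) Hpx) as [w [Hw1 Hw2]]; [lra|].
specialize (Hball w). lra.
Qed.

(** A segment longer than 1 is cut after a unit piece, to which the hypothesis on unit balls
    applies; induction handles the rest. *)
Lemma le_nat_transfer (n : nat) x y : d x y <= INR n -> d' x y <= INR n.
Proof.
revert x y. induction n as [|n IH]; intros x y H.
- simpl in *. assert (E : x = y).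
  { apply (metric_eq X d Hm). pose proof (metric_pos X d Hm x y). lra. }
  rewrite E, metric_refl by assumption. lra.
- destruct (Rle_lt_dec (d x y) 1) as [L|L].
  + apply H1 in L. rewrite S_INR. pose proof (pos_INR n). lra.
  + rewrite S_INR in *.
    assert (Hl : 0 <= 1 / d x y <= 1).
    { split; [apply Rlt_le, Rdiv_lt_0_compat; lra|].
      apply Rmult_le_reg_r with (d x y); [lra|]. unfold Rdiv.
      rewrite Rmult_assoc, Rinv_l; lra. }
    destruct (btw_exists X d Hm Hc x y (1 / d x y) Hl) as [m [B1 B2]].
    assert (E1 : d x m = 1) by (rewrite B1; field; lra).
    assert (E2 : d m y = d x y - 1) by (rewrite B2; field; lra).
    assert (d' x m <= 1) by (apply H1; lra).
    assert (d' m y <= INR n) by (apply IH; lra).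
    pose proof (metric_tri X d' Hm' m x y). lra.
Qed.

End SameTopology.

Section Comparison.
Variables (X : Type) (d d' : X -> X -> R).
Hypotheses (Hm : is_metric d) (Hc : CAT0 d) (Hlc : locally_compact d)
  (Hm' : is_metric d') (Hc' : CAT0 d') (Hgc' : geodesically_complete d')
  (H1 : forall x y, d x y <= 1 <-> d' x y <= 1).

(** If [d' x y] were equal to [n], a short [d']-prolongation beyond [y] would exceed [n] for [d']
    while staying below [n] for [d], since the [d']-topology controls [d]. *)
Lemma lt_nat_transfer (n : nat) x y : d x y < INR n -> d' x y < INR n.
Proof.
intros H. pose proof (le_nat_transfer X d d' Hm Hc Hm' H1 n x y ltac:(lra)) as L.
destruct L as [|E]; [assumption|exfalso].
destruct (topology_coarser X d d' Hm Hc Hlc Hm' Hgc' H1 y (INR n - d x y)) as [del [Hd Hdel]];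
  [lra|].
assert (Hxy : x <> y).
{ intros ->. rewrite metric_refl in E, H by assumption. lra. }
destruct (segment_extension X d' Hm' Hgc' x y (del / 2) Hxy) as [w [W1 W2]]; [lra|].
specialize (Hdel w ltac:(lra)).
pose proof (metric_tri X d Hm y x w).
assert (d x w <= INR n) as L2 by lra.
apply (le_nat_transfer X d d' Hm Hc Hm' H1) in L2. lra.
Qed.

Lemma dist_diff_le x y : d' x y <= d x y + 1.
Proof.
pose proof (metric_pos X d Hm x y).
destruct (archimed (d x y)) as [A B].
assert (0 <= up (d x y))%Z by (apply le_IZR; lra).
pose proof (le_nat_transfer X d d' Hm Hc Hm' H1 (Z.to_nat (up (d x y))) x y) as K.
rewrite INR_IZR_INZ, Z2Nat.id in K by assumption. lra.
Qed.

End Comparison.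

(** * Lines that are geodesic at integer distances *)

Definition reversed {X : Type} (b : R -> X) : R -> X := fun t => b (- t).

Section Busemann.
Variables (X : Type) (d : X -> X -> R).
Hypotheses (Hm : is_metric d) (Hc : CAT0 d).

(* A [d]-geodesic line has this property for both metrics. *)
Definition pgeod (b : R -> X) : Prop :=
  (forall s n, d (b s) (b (s + INR n)) = INR n) /\
  (forall s t, d (b s) (b t) <= Rabs (s - t) + 1).

(** The Busemann function of the positive end, sampled at integers because only integer steps are
    geodesic for both metrics. *)
Definition bus (b : R -> X) (x : X) : R := infn (fun n => d x (b (INR n)) - INR n).

Definition psi (b : R -> X) (s : R) : R := - bus b (b s).

Lemma geodesic_pgeod b : complete_geodesic d b -> pgeod b.
Proof.
intros Hb. split.
- intros s n. rewrite Hb, <- Rabs_Ropp, Rabs_right; pose proof (pos_INR n); lra.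
- intros s t. rewrite Hb. lra.
Qed.

Lemma pgeod_rev b : pgeod b -> pgeod (reversed b).
Proof.
intros [H1 H2]. unfold reversed. split.
- intros s n. rewrite metric_sym by assumption.
  pose proof (H1 (- (s + INR n)) n) as E.
  now replace (- (s + INR n) + INR n) with (- s) in E by ring.
- intros s t. eapply Rle_trans; [apply H2|]. apply Req_le.
  rewrite <- Rabs_Ropp. do 2 f_equal. ring.
Qed.

(** The distance [h x] between the two points moved by [x] is convex along unit steps. A nonzero
    increment would persist in one direction and contradict the boundedness of [h]. *)
Lemma pgeod_unit_shift b s t : pgeod b -> d (b s) (b t) = d (b (s + 1)) (b (t + 1)).
Proof.
intros [H1 H2].
set (h := fun x => d (b (s + x)) (b (t + x))).
assert (Hb : forall x, 0 <= h x <= Rabs (s - t) + 1).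
{ intros x. split; [now apply metric_pos|]. unfold h.
  replace (s - t) with ((s + x) - (t + x)) by ring. apply H2. }
assert (Hmid : forall x, btw X d (b (x - 1)) (b (x + 1)) (1 / 2) (b x)).
{ intros x. pose proof (H1 (x - 1) 1%nat) as E1. pose proof (H1 x 1%nat) as E2.
  pose proof (H1 (x - 1) 2%nat) as E3. simpl in *.
  replace (x - 1 + 1) with x in E1 by ring.
  replace (x - 1 + (1 + 1)) with (x + 1) in E3 by ring.
  split; lra. }
assert (Hcv : forall x, h x <= (h (x - 1) + h (x + 1)) / 2).
{ intros x. unfold h.
  pose proof (btw_convex X d Hm Hc _ _ _ _ (1/2) _ _ ltac:(lra)
    (Hmid (s + x)) (Hmid (t + x))) as K.
  replace (s + (x - 1)) with (s + x - 1) by ring.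
  replace (t + (x - 1)) with (t + x - 1) by ring.
  replace (s + (x + 1)) with (s + x + 1) by ring.
  replace (t + (x + 1)) with (t + x + 1) by ring. lra. }
set (e := h 1 - h 0).
assert (Up : forall n, h (INR n + 1) - h (INR n) >= e /\ h (INR n) >= h 0 + INR n * e).
{ induction n as [|n [IH1 IH2]].
  - simpl. unfold e. rewrite Rplus_0_l. lra.
  - rewrite S_INR. specialize (Hcv (INR n + 1)).
    replace (INR n + 1 - 1) with (INR n) in Hcv by ring. split; lra. }
assert (Dn : forall n, h (1 - INR n) - h (- INR n) <= e /\ h (- INR n) >= h 0 - INR n * e).
{ induction n as [|n [IH1 IH2]].
  - simpl. unfold e. rewrite Ropp_0, Rminus_0_r. lra.
  - rewrite S_INR. specialize (Hcv (- INR n)).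
    replace (- INR n + 1) with (1 - INR n) in Hcv by ring.
    replace (- INR n - 1) with (- (INR n + 1)) in Hcv by ring.
    replace (1 - (INR n + 1)) with (- INR n) by ring. split; lra. }
assert (e = 0).
{ destruct (Rtotal_order e 0) as [L|[Z|G]]; [exfalso|assumption|exfalso].
  - destruct (nat_above ((Rabs (s - t) + 1) / - e)) as [n Hn].
    apply Rmult_lt_compat_r with (r := - e) in Hn; [|lra].
    unfold Rdiv in Hn. rewrite Rmult_assoc, Rinv_l in Hn by lra.
    pose proof (Hb (- INR n)). pose proof (Dn n). pose proof (Hb 0). lra.
  - destruct (nat_above ((Rabs (s - t) + 1) / e)) as [n Hn].
    apply Rmult_lt_compat_r with (r := e) in Hn; [|lra].
    unfold Rdiv in Hn. rewrite Rmult_assoc, Rinv_l in Hn by lra.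
    pose proof (Hb (INR n)). pose proof (Up n). pose proof (Hb 0). lra. }
unfold e, h in H. rewrite !Rplus_0_r in H. lra.
Qed.

Lemma pgeod_shift b s t s' t' n : pgeod b -> s' = s + INR n -> t' = t + INR n ->
  d (b s') (b t') = d (b s) (b t).
Proof.
intros Hb -> ->. induction n as [|n IH].
- simpl. now rewrite !Rplus_0_r.
- rewrite S_INR, <- !Rplus_assoc, <- pgeod_unit_shift; assumption.
Qed.

Lemma bus_decr b x s : pgeod b -> decr (fun n => d x (b (s + INR n)) - INR n).
Proof.
intros [H1 _] n. rewrite S_INR.
pose proof (metric_tri X d Hm (b (s + INR n)) x (b (s + (INR n + 1)))).
pose proof (H1 (s + INR n) 1%nat) as E. simpl in E.
rewrite Rplus_assoc in E. lra.
Qed.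

Lemma bus_bounded b x s : pgeod b ->
  forall n, - d x (b s) <= d x (b (s + INR n)) - INR n.
Proof.
intros [H1 _] n. rewrite (metric_sym X d Hm x (b s)).
pose proof (metric_tri X d Hm x (b s) (b (s + INR n))). specialize (H1 s n). lra.
Qed.

Lemma bus_is_inf b x : pgeod b -> is_inf (fun n => d x (b (INR n)) - INR n) (bus b x).
Proof.
intros Hb. apply infn_spec with (M := - d x (b 0)). intros n.
pose proof (bus_bounded b x 0 Hb n) as K. now rewrite Rplus_0_l in K.
Qed.

Lemma bus_decr0 b x : pgeod b -> decr (fun n => d x (b (INR n)) - INR n).
Proof.
intros Hb n. pose proof (bus_decr b x 0 Hb n) as K. simpl in K.
now rewrite !Rplus_0_l in K.
Qed.

Lemma bus_le b x y : pgeod b -> bus b x <= bus b y + d x y.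
Proof.
intros Hb. apply (is_inf_le_shift _ _ _ _ _ 0 0 (bus_is_inf b x Hb) (bus_decr0 b y Hb)
  (bus_is_inf b y Hb)).
intros n _. rewrite Nat.add_0_r. pose proof (metric_tri X d Hm y x (b (INR n))). lra.
Qed.

Lemma bus_lip b x y : pgeod b -> Rabs (bus b x - bus b y) <= d x y.
Proof.
intros Hb. pose proof (bus_le b x y Hb). pose proof (bus_le b y x Hb).
rewrite (metric_sym X d Hm y x) in *. apply Rabs_le; lra.
Qed.

Lemma psi_lip b s t : pgeod b -> Rabs (psi b s - psi b t) <= d (b s) (b t).
Proof.
intros Hb. unfold psi. rewrite <- Rabs_Ropp.
replace (- (- bus b (b s) - - bus b (b t))) with (bus b (b s) - bus b (b t)) by ring.
now apply bus_lip.
Qed.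

(** Passing through [x] is no shorter than the distance [2 n] from [b (-n)] to [b n]. *)
Lemma bus_sum_nonneg b x : pgeod b -> 0 <= bus b x + bus (reversed b) x.
Proof.
intros Hb. pose proof (bus_is_inf b x Hb) as I1.
pose proof (bus_is_inf (reversed b) x (pgeod_rev b Hb)) as I2.
cut (- bus b x <= bus (reversed b) x); [lra|].
apply Rle_add_eps. intros e He.
destruct (is_inf_eventually _ _ (e / 2) (bus_decr0 b x Hb) I1) as [N HN]; [lra|].
destruct (is_inf_eventually _ _ (e / 2) (bus_decr0 _ x (pgeod_rev b Hb)) I2) as [M HM]; [lra|].
specialize (HN (N + M)%nat ltac:(lia)). specialize (HM (N + M)%nat ltac:(lia)).
set (n := (N + M)%nat) in *. cbv beta in HN, HM.
change (reversed b (INR n)) with (b (- INR n)) in HM.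
pose proof (metric_tri X d Hm x (b (- INR n)) (b (INR n))) as T.
rewrite (metric_sym X d Hm (b (- INR n)) x) in T.
pose proof (proj1 Hb (- INR n) (n + n)%nat) as E. rewrite plus_INR in E.
replace (- INR n + (INR n + INR n)) with (INR n) in E by ring. lra.
Qed.

(* The quadrilateral inequality for [b (-N), b N, b (s + N), b (s - N)], whose
   diagonals are at least [2 N - bus b (b s)] and [2 N - bus (reversed b) (b s)] up
   to sign, excludes a positive sum when [N] is large. *)
Lemma bus_rev_on_line b s : pgeod b -> bus (reversed b) (b s) = psi b s.
Proof.
intros Hb. unfold psi. pose proof (bus_sum_nonneg b (b s) Hb) as P.
set (u := bus b (b s)) in *. set (v := bus (reversed b) (b s)) in *.
cut (v + u <= 0); [lra|].
pose proof (bus_is_inf b (b s) Hb) as [I1 _].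
pose proof (bus_is_inf (reversed b) (b s) (pgeod_rev b Hb)) as [I2 _].
fold u in I1. fold v in I2. unfold reversed in I2. cbv beta in I1, I2.
set (D := Rabs s + 1).
assert (HD : forall x, 0 <= d (b x) (b (s + x)) <= D).
{ intros x. split; [now apply metric_pos|]. unfold D.
  pose proof (proj2 Hb x (s + x)) as K.
  replace (x - (s + x)) with (- s) in K by ring. now rewrite Rabs_Ropp in K. }
destruct (Rle_lt_dec (v + u) 0) as [|C]; [assumption|exfalso].
(* [N0] makes the gain of the diagonals, linear in [N], exceed the two bounded sides; [N1] below
   makes [2 N + u] and [2 N + v] nonnegative, so that they may be squared. *)
destruct (nat_above ((2 * D ^ 2 + Rabs u + Rabs v) / (v + u))) as [N0 HN0].
apply Rmult_lt_compat_r with (r := v + u) in HN0; [|lra].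
unfold Rdiv in HN0. rewrite Rmult_assoc, Rinv_l in HN0 by lra.
destruct (nat_above (Rabs u + Rabs v)) as [N1 HN1].
set (N := (N0 + N1)%nat). assert (EN : INR N = INR N0 + INR N1) by apply plus_INR.
pose proof (quadrilateral_ineq X d Hm Hc (b (- INR N)) (b (INR N)) (b (s + INR N)) (b (s - INR N))) as Q.
specialize (I1 (N + N)%nat). specialize (I2 (N + N)%nat). rewrite plus_INR in I1, I2.
assert (E1 : d (b (- INR N)) (b (s + INR N)) = d (b s) (b (- (INR N + INR N)))).
{ rewrite (metric_sym X d Hm (b s)).
  apply (pgeod_shift b _ _ _ _ N Hb); ring. }
assert (E2 : d (b (INR N)) (b (s - INR N)) = d (b s) (b (INR N + INR N))).
{ rewrite (metric_sym X d Hm (b (INR N))). symmetry.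
  apply (pgeod_shift b _ _ _ _ N Hb); ring. }
assert (E3 : d (b (- INR N)) (b (INR N)) = 2 * INR N).
{ pose proof (proj1 Hb (- INR N) (N + N)%nat) as E. rewrite plus_INR in E.
  replace (- INR N + (INR N + INR N)) with (INR N) in E by ring. lra. }
assert (E4 : d (b (s + INR N)) (b (s - INR N)) = 2 * INR N).
{ rewrite (metric_sym X d Hm). pose proof (proj1 Hb (s - INR N) (N + N)%nat) as E.
  rewrite plus_INR in E.
  replace (s - INR N + (INR N + INR N)) with (s + INR N) in E by ring. lra. }
pose proof (HD (INR N)) as D1. pose proof (HD (- INR N)) as D2.
rewrite (metric_sym X d Hm (b (s - INR N))) in Q.
replace (s + - INR N) with (s - INR N) in D2 by ring.
rewrite E1, E2, E3, E4 in Q.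
set (A := d (b s) (b (- (INR N + INR N)))) in *.
set (B := d (b s) (b (INR N + INR N))) in *.
pose proof (Rle_abs u). pose proof (Rle_abs v).
pose proof (Rle_abs (- u)) as U2. rewrite Rabs_Ropp in U2.
pose proof (Rle_abs (- v)) as V2. rewrite Rabs_Ropp in V2.
pose proof (pos_INR N0). pose proof (pos_INR N1).
assert (d (b (INR N)) (b (s + INR N)) ^ 2 <= D ^ 2) by (apply pow_incr; lra).
assert (d (b (- INR N)) (b (s - INR N)) ^ 2 <= D ^ 2) by (apply pow_incr; lra).
assert ((2 * INR N + v) ^ 2 <= A ^ 2) by (apply pow_incr; lra).
assert ((2 * INR N + u) ^ 2 <= B ^ 2) by (apply pow_incr; lra).
pose proof (Rabs_pos u). pose proof (Rabs_pos v).
assert (2 * D ^ 2 < INR N * (v + u)) by (rewrite EN; nra).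
pose proof (pow2_ge_0 u). pose proof (pow2_ge_0 v). pose proof (pow2_ge_0 D). nra.
Qed.

Lemma bus_rev_is_inf b s : pgeod b ->
  is_inf (fun n => d (b s) (b (- INR n)) - INR n) (psi b s).
Proof.
intros Hb. rewrite <- bus_rev_on_line by assumption.
exact (bus_is_inf (reversed b) (b s) (pgeod_rev b Hb)).
Qed.

Lemma psi_rev b s : pgeod b -> psi (reversed b) s = - psi b (- s).
Proof.
intros Hb. unfold psi at 1. unfold reversed at 2.
now rewrite bus_rev_on_line.
Qed.

(** The upper estimate uses [psi b s] as a limit along the negative end of [b], the lower one as a
    limit along the positive end. They agree by [bus_rev_on_line]. *)
Lemma bus_shift b x s : pgeod b ->
  is_inf (fun n => d x (b (s + INR n)) - INR n) (bus b x + psi b s).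
Proof.
intros Hb.
pose proof (infn_spec _ _ (bus_bounded b x s Hb)) as I.
set (w := infn _) in I.
enough (E : w = bus b x + psi b s) by now rewrite <- E.
pose proof (bus_is_inf b x Hb) as I0.
apply Rle_antisym; apply Rle_add_eps; intros e He.
- destruct (proj2 (bus_rev_is_inf b s Hb) e He) as [L HL].
  apply Rle_lt_trans with (bus b x + (d (b s) (b (- INR L)) - INR L)); [|lra].
  apply (is_inf_le_shift _ _ _ _ _ 0 L I (bus_decr0 b x Hb) I0).
  intros n _. rewrite plus_INR.
  pose proof (metric_tri X d Hm (b (INR n)) x (b (s + (INR n + INR L)))) as T.
  rewrite (pgeod_shift b (- INR L) s (INR n) (s + (INR n + INR L)) (n + L) Hb) in T
    by (rewrite plus_INR; ring).
  rewrite (metric_sym X d Hm (b (- INR L))) in T. lra.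
- destruct (proj2 (bus_is_inf b (b s) Hb) e He) as [L HL].
  apply Rle_lt_trans with (w + (d (b s) (b (INR L)) - INR L) - bus b (b s) + bus b (b s) + psi b s);
    unfold psi in *; [|lra].
  enough (bus b x <= w + (d (b s) (b (INR L)) - INR L)) by lra.
  apply (is_inf_le_shift _ _ _ _ _ 0 L I0 (bus_decr b x s Hb) I).
  intros n _. rewrite plus_INR.
  pose proof (metric_tri X d Hm (b (s + INR n)) x (b (INR n + INR L))) as T.
  rewrite (pgeod_shift b s (INR L) (s + INR n) (INR n + INR L) n Hb) in T by ring.
  lra.
Qed.

Lemma psi_zero b : pgeod b -> psi b 0 = 0.
Proof.
intros Hb. unfold psi. apply Ropp_eq_0_compat.
apply is_inf_unique with (f := fun n => d (b 0) (b (INR n)) - INR n).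
- now apply bus_is_inf.
- assert (E : forall n, d (b 0) (b (INR n)) - INR n = 0).
  { intros n. pose proof (proj1 Hb 0 n) as E. rewrite Rplus_0_l in E. lra. }
  split; intros; [|exists O]; rewrite E; lra.
Qed.

Lemma psi_unit b s : pgeod b -> psi b (s + 1) = psi b s + 1.
Proof.
intros Hb.
pose proof (bus_shift b (b 0) s Hb) as I.
pose proof (bus_shift b (b 0) (s + 1) Hb) as J.
enough (bus b (b 0) + psi b (s + 1) = bus b (b 0) + psi b s + 1) by lra.
apply Rle_antisym.
- apply (is_inf_le_shift _ _ _ _ _ 1 0 J (bus_decr _ _ _ Hb) I).
  intros n _. rewrite Nat.add_0_r.
  pose proof (bus_decr b (b 0) s Hb n) as K. cbv beta in K. rewrite S_INR in K.
  replace (s + 1 + INR n) with (s + (INR n + 1)) by ring. lra.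
- enough (bus b (b 0) + psi b s <= bus b (b 0) + psi b (s + 1) + -1) by lra.
  apply (is_inf_le_shift _ _ _ _ _ 0 1 I (bus_decr _ _ _ Hb) J).
  intros n _. rewrite plus_INR. simpl.
  replace (s + 1 + INR n) with (s + (INR n + 1)) by ring. lra.
Qed.

Lemma psi_geodesic b s : complete_geodesic d b -> psi b s = s.
Proof.
intros Hb. pose proof (geodesic_pgeod b Hb) as Hp. unfold psi.
enough (bus b (b s) = - s) by lra.
apply is_inf_unique with (f := fun n => d (b s) (b (INR n)) - INR n).
- now apply bus_is_inf.
- split.
  + intros n. rewrite Hb. pose proof (Rle_abs (- (s - INR n))) as K.
    rewrite Rabs_Ropp in K. lra.
  + intros e He. destruct (nat_above s) as [n Hn]. exists n.
    rewrite Hb, <- Rabs_Ropp, Rabs_right; lra.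
Qed.

(** * The distance between two ends at infinity *)

(** The renormalized distance from the negative end of [b] to the positive end of [c]. It decreases
    with [k], and its infimum plays the role of a Busemann value between two ends. *)
Definition endpair (b c : R -> X) (s t : R) (k : nat) : R :=
  d (b (s - INR k)) (c (t + INR k)) - 2 * INR k.

Lemma endpair_decr b c s t : pgeod b -> pgeod c -> decr (endpair b c s t).
Proof.
intros Hb Hcc k. unfold endpair. rewrite S_INR.
pose proof (metric_tri X d Hm (b (s - INR k)) (b (s - (INR k + 1))) (c (t + (INR k + 1)))).
pose proof (metric_tri X d Hm (c (t + INR k)) (b (s - INR k)) (c (t + (INR k + 1)))).
pose proof (proj1 Hb (s - (INR k + 1)) 1%nat) as E1.
pose proof (proj1 Hcc (t + INR k) 1%nat) as E2. simpl in *.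
replace (s - (INR k + 1) + 1) with (s - INR k) in E1 by ring.
rewrite Rplus_assoc in E2. lra.
Qed.

Lemma endpair_rev b c s t k : endpair b c s t k = endpair (reversed c) (reversed b) (- t) (- s) k.
Proof.
unfold endpair, reversed. rewrite (metric_sym X d Hm).
do 4 f_equal; ring.
Qed.

Lemma endpair_bounded b c M : pgeod b -> pgeod c ->
  (forall k, M <= endpair b c 0 0 k) ->
  forall s t k, M - Rabs s - Rabs t - 2 <= endpair b c s t k.
Proof.
intros Hb Hcc HM s t k. specialize (HM k). unfold endpair in *.
pose proof (metric_tri X d Hm (b (s - INR k)) (b (0 - INR k)) (c (0 + INR k))).
pose proof (metric_tri X d Hm (c (t + INR k)) (b (s - INR k)) (c (0 + INR k))).
pose proof (proj2 Hb (0 - INR k) (s - INR k)) as A1.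
pose proof (proj2 Hcc (t + INR k) (0 + INR k)) as A2.
replace (0 - INR k - (s - INR k)) with (- s) in A1 by ring.
replace (t + INR k - (0 + INR k)) with t in A2 by ring.
rewrite Rabs_Ropp in A1. lra.
Qed.

Lemma endpair_shift_left b c s t (l l0 : R) : pgeod b -> pgeod c ->
  is_inf (endpair b c s t) l -> is_inf (endpair b c 0 t) l0 -> l = l0 - psi b s.
Proof.
intros Hb Hcc I I0. apply Rle_antisym; apply Rle_add_eps; intros e He.
- destruct (proj2 (bus_is_inf b (b s) Hb) e He) as [L HL]. unfold psi.
  enough (l <= l0 + (d (b s) (b (INR L)) - INR L)) by lra.
  apply (is_inf_le_shift _ _ _ _ _ 0 L I (endpair_decr b c 0 t Hb Hcc) I0).
  intros n _. unfold endpair. rewrite plus_INR.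
  pose proof (metric_tri X d Hm (b (0 - INR n)) (b (s - (INR n + INR L))) (c (t + (INR n + INR L)))).
  pose proof (metric_tri X d Hm (c (t + INR n)) (b (0 - INR n)) (c (t + (INR n + INR L)))).
  pose proof (proj1 Hcc (t + INR n) L) as E. rewrite Rplus_assoc in E.
  pose proof (pgeod_shift b (s - (INR n + INR L)) (0 - INR n) s (INR L) (n + L) Hb) as E2.
  rewrite plus_INR in E2. specialize (E2 ltac:(ring) ltac:(ring)). lra.
- destruct (proj2 (bus_rev_is_inf b s Hb) e He) as [L HL].
  enough (l0 <= l + (d (b s) (b (- INR L)) - INR L)) by lra.
  apply (is_inf_le_shift _ _ _ _ _ 0 L I0 (endpair_decr b c s t Hb Hcc) I).
  intros n _. unfold endpair. rewrite plus_INR.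
  pose proof (metric_tri X d Hm (b (s - INR n)) (b (0 - (INR n + INR L))) (c (t + (INR n + INR L)))).
  pose proof (metric_tri X d Hm (c (t + INR n)) (b (s - INR n)) (c (t + (INR n + INR L)))).
  pose proof (proj1 Hcc (t + INR n) L) as E. rewrite Rplus_assoc in E.
  pose proof (pgeod_shift b (0 - (INR n + INR L)) (s - INR n) (- INR L) s n Hb) as E2.
  specialize (E2 ltac:(ring) ltac:(ring)).
  rewrite (metric_sym X d Hm (b s) (b (- INR L))). lra.
Qed.

(** The base point on [b] is moved as in [bus_shift]; the one on [c] follows by reversing and
    exchanging the two lines. *)
Lemma endpair_shift b c M s t : pgeod b -> pgeod c ->
  (forall k, M <= endpair b c 0 0 k) ->
  is_inf (endpair b c s t) (infn (endpair b c 0 0) - psi b s + psi c t).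
Proof.
intros Hb Hcc HM.
pose proof (endpair_bounded b c M Hb Hcc HM) as B.
pose proof (infn_spec _ _ HM) as I00.
pose proof (infn_spec _ _ (B 0 t)) as I0t.
pose proof (infn_spec _ _ (B s t)) as Ist.
pose proof (endpair_shift_left b c s t _ _ Hb Hcc Ist I0t) as E1.
assert (R : forall s' t' l, is_inf (endpair b c s' t') l ->
  is_inf (endpair (reversed c) (reversed b) (- t') (- s')) l).
{ intros s' t' l [J1 J2]. split.
  - intros n. rewrite <- endpair_rev. apply J1.
  - intros e He. destruct (J2 e He) as [n Hn]. exists n. now rewrite <- endpair_rev. }
apply R in I0t as J0t. apply R in I00 as J00. rewrite Ropp_0 in J0t, J00.
pose proof (endpair_shift_left _ _ _ _ _ _ (pgeod_rev c Hcc) (pgeod_rev b Hb) J0t J00) as E2.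
rewrite psi_rev, Ropp_involutive in E2 by assumption.
replace (_ - _ + _) with (infn (endpair b c s t)) by lra. exact Ist.
Qed.

End Busemann.

(** * Busemann functions and ends under the change of metric *)

Lemma is_inf_neg (f : nat -> R) (l : R) : is_inf f l -> (l < 0 <-> exists n, f n < 0).
Proof.
intros [H1 H2]. split.
- intros Hl. destruct (H2 (- l)) as [n Hn]; [lra|]. exists n. lra.
- intros [n Hn]. specialize (H1 n). lra.
Qed.

Lemma bus_ext (X : Type) (d : X -> X -> R) b c x :
  (forall n, b (INR n) = c (INR n)) -> bus X d b x = bus X d c x.
Proof.
intros E. unfold bus. f_equal. apply functional_extensionality. intros n. now rewrite E.
Qed.

(** Consecutive integer points are joined by unit segments. The concatenation is geodesic because
    the distance between any two integer points already equals the length of the path between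
    them. *)
Lemma line_through_integers (X : Type) (d : X -> X -> R) (f : R -> X) :
  is_metric d -> geodesic_space d ->
  (forall s n, d (f s) (f (s + INR n)) = INR n) ->
  exists c, complete_geodesic d c /\ forall i : Z, c (IZR i) = f (IZR i).
Proof.
intros Hm Hg Hf.
assert (Hij : forall i j, (i <= j)%Z -> d (f (IZR i)) (f (IZR j)) = IZR j - IZR i).
{ intros i j Hij. specialize (Hf (IZR i) (Z.to_nat (j - i))).
  rewrite INR_IZR_INZ, Z2Nat.id, minus_IZR in Hf by lia.
  now replace (IZR i + (IZR j - IZR i)) with (IZR j) in Hf by ring. }
assert (S : forall i : Z, exists c, geodesic_from_to d c (f (IZR i)) (f (IZR (i + 1))))
  by (intros i; apply Hg).
destruct (choice _ S) as [c Hcc]. clear S.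
assert (H1 : forall i, d (f (IZR i)) (f (IZR (i + 1))) = 1).
{ intros i. rewrite Hij by lia. rewrite plus_IZR. ring. }
set (fl := Int_part).
assert (Hfl : forall t, 0 <= t - IZR (fl t) <= 1).
{ intros t. pose proof (base_Int_part t). unfold fl. lra. }
assert (Hi : forall t i, 0 <= t - IZR i <= 1 ->
  d (c i (t - IZR i)) (f (IZR i)) = t - IZR i /\
  d (c i (t - IZR i)) (f (IZR (i + 1))) = IZR (i + 1) - t).
{ intros t i Ht. destruct (Hcc i) as (E0 & E1 & Hiso). rewrite H1 in *. split.
  - rewrite <- E0, Hiso, Rabs_right by lra. lra.
  - rewrite <- E1, Hiso, <- Rabs_Ropp, Rabs_right by lra. rewrite plus_IZR. lra. }
set (beta := fun t => c (fl t) (t - IZR (fl t))).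
assert (Hbeta : forall s t, s <= t -> d (beta s) (beta t) = t - s).
{ intros s t Hst. unfold beta.
  destruct (Z.eq_dec (fl s) (fl t)) as [E|E].
  - rewrite E. pose proof (Hfl s) as A. rewrite E in A. pose proof (Hfl t).
    destruct (Hcc (fl t)) as (_ & _ & Hiso). rewrite H1 in Hiso.
    rewrite Hiso, <- Rabs_Ropp, Rabs_right by lra. ring.
  - assert (L : (fl s + 1 <= fl t)%Z).
    { assert (fl s < fl t + 1)%Z; [|lia]. apply lt_IZR. rewrite plus_IZR.
      pose proof (base_Int_part s). pose proof (base_Int_part t). unfold fl. lra. }
    destruct (Hi s (fl s) (Hfl s)) as [A1 A2].
    destruct (Hi t (fl t) (Hfl t)) as [B1 B2].
    pose proof (Hij _ _ L) as C1.
    pose proof (Hij (fl s) (fl t + 1)%Z ltac:(lia)) as C2.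
    set (p := c (fl s) _) in *. set (q := c (fl t) _) in *.
    pose proof (metric_tri X d Hm (f (IZR (fl s + 1))) p q).
    pose proof (metric_tri X d Hm (f (IZR (fl t))) (f (IZR (fl s + 1))) q).
    pose proof (metric_tri X d Hm p (f (IZR (fl s))) (f (IZR (fl t + 1)))).
    pose proof (metric_tri X d Hm q p (f (IZR (fl t + 1)))).
    rewrite (metric_sym X d Hm (f (IZR (fl t))) q) in *.
    rewrite (metric_sym X d Hm (f (IZR (fl s))) p) in *.
    lra. }
exists beta. split.
- intros s t. destruct (Rle_lt_dec s t) as [L|L].
  + rewrite Hbeta, <- Rabs_Ropp, Rabs_right by lra. ring.
  + rewrite metric_sym, Hbeta, Rabs_right by (assumption || lra). ring.
- intros i. apply (metric_eq X d Hm). unfold beta.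
  assert (E : fl (IZR i) = i).
  { pose proof (base_Int_part (IZR i)) as [A B]. fold fl in A, B.
    assert (fl (IZR i) <= i)%Z by now apply le_IZR.
    assert (i < fl (IZR i) + 1)%Z; [|lia]. apply lt_IZR. rewrite plus_IZR. lra. }
  rewrite E. destruct (Hi (IZR i) i) as [A _]; [lra|]. rewrite A. ring.
Qed.

Definition flat {X : Type} (d : X -> X -> R) (b : R -> X) (g : X) : Prop :=
  bus X d b g + bus X d (reversed b) g = 0.

Definition flat_free {X : Type} (d : X -> X -> R) (b : R -> X) : Prop :=
  forall g, flat d b g -> exists s, g = b s.

Definition nice {X : Type} (d : X -> X -> R) : Prop :=
  is_metric d /\ CAT0 d /\ locally_compact d /\ geodesically_complete d.

Lemma complete_geodesic_rev (X : Type) (d : X -> X -> R) b :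
  complete_geodesic d b -> complete_geodesic d (reversed b).
Proof.
intros Hb s t. unfold reversed. rewrite Hb, <- Rabs_Ropp. f_equal. ring.
Qed.

Section Transfer.
Variables (X : Type) (d d' : X -> X -> R).
Hypotheses (HN : nice d) (HN' : nice d')
  (H1 : forall x y, d x y <= 1 <-> d' x y <= 1).

Lemma lt_nat_iff n x y : d x y < INR n <-> d' x y < INR n.
Proof.
destruct HN as (Hm & Hc & Hl & Hg). destruct HN' as (Hm' & Hc' & Hl' & Hg').
split; apply lt_nat_transfer; try assumption. intros; now rewrite H1.
Qed.

Lemma eq_nat_transfer n x y : d x y = INR n -> d' x y = INR n.
Proof.
destruct HN as (Hm & Hc & Hl & Hg). destruct HN' as (Hm' & Hc' & Hl' & Hg').
intros E. apply Rle_antisym.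
- apply (le_nat_transfer X d d'); try assumption. lra.
- apply Rnot_lt_le. intros C. apply lt_nat_iff in C. lra.
Qed.

Lemma geodesic_pgeod_transfer b : complete_geodesic d b -> pgeod X d' b.
Proof.
destruct HN as (Hm & Hc & Hl & Hg). destruct HN' as (Hm' & Hc' & Hl' & Hg').
intros Hb. split.
- intros s n. apply eq_nat_transfer. now apply geodesic_pgeod.
- intros s t. rewrite <- Hb. now apply dist_diff_le.
Qed.

Lemma psi_cont b s e : complete_geodesic d b -> 0 < e ->
  exists del, 0 < del /\ forall t, Rabs (s - t) < del ->
    Rabs (psi X d' b s - psi X d' b t) < e.
Proof.
destruct HN as (Hm & Hc & Hl & Hg). destruct HN' as (Hm' & Hc' & Hl' & Hg').
intros Hb He.
destruct (topology_coarser X d' d Hm' Hc' Hl' Hm Hg (fun x y => iff_sym (H1 x y)) (b s) e He)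
  as [del [Hdel K]].
exists del. split; [assumption|]. intros t Ht.
eapply Rle_lt_trans; [apply psi_lip; try assumption; now apply geodesic_pgeod_transfer|].
apply K. now rewrite Hb.
Qed.

(** Both sides say that a shifted infimum is negative, that is, that the distance from [x] to
    [b (s + n)] is less than [n] for some [n]. The two metrics agree on this. *)
Lemma bus_transfer b x s : complete_geodesic d b ->
  (bus X d b x < - s <-> bus X d' b x < - psi X d' b s).
Proof.
destruct HN as (Hm & Hc & Hl & Hg). destruct HN' as (Hm' & Hc' & Hl' & Hg').
intros Hb.
pose proof (is_inf_neg _ _ (bus_shift X d Hm Hc b x s (geodesic_pgeod X d b Hb))) as A.
pose proof (is_inf_neg _ _ (bus_shift X d' Hm' Hc' b x s (geodesic_pgeod_transfer b Hb))) as B.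
rewrite (psi_geodesic X d Hm) in A by assumption.
assert (E : (exists n, d x (b (s + INR n)) - INR n < 0) <->
            (exists n, d' x (b (s + INR n)) - INR n < 0)).
{ split; intros [n Hn]; exists n.
  - assert (d' x (b (s + INR n)) < INR n) by (apply lt_nat_iff; lra). lra.
  - assert (d x (b (s + INR n)) < INR n) by (apply lt_nat_iff; lra). lra. }
split; intros K.
- assert (bus X d b x + s < 0) as K2 by lra. apply A, E, B in K2. lra.
- assert (bus X d' b x + psi X d' b s < 0) as K2 by lra. apply B, E, A in K2. lra.
Qed.

(** The sublevel sets correspond by [bus_transfer]; continuity of [psi] turns this into an equality
    of values. *)
Lemma bus_transform b x : complete_geodesic d b ->
  bus X d' b x = - psi X d' b (- bus X d b x).
Proof.
intros Hb. set (th := - bus X d b x).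
apply Rle_antisym.
- apply Rle_add_eps. intros e He.
  destruct (psi_cont b th e Hb He) as [del [Hdel K]].
  specialize (K (th - del / 2)).
  rewrite Rabs_right in K by lra. specialize (K ltac:(lra)).
  apply Rabs_def2 in K.
  assert (bus X d b x < - (th - del / 2)) as K2 by (unfold th; lra).
  apply (bus_transfer b x _ Hb) in K2. lra.
- apply Rnot_lt_le. intros C. apply (bus_transfer b x _ Hb) in C. unfold th in C. lra.
Qed.

Lemma psi_incr b s t : complete_geodesic d b -> s < t -> psi X d' b s < psi X d' b t.
Proof.
destruct HN as (Hm & Hc & Hl & Hg).
intros Hb Hst.
assert (bus X d b (b t) < - s) as K.
{ pose proof (psi_geodesic X d Hm b t Hb) as E. unfold psi in E. lra. }
apply (bus_transfer b (b t) s Hb) in K. unfold psi in *. lra.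
Qed.

Lemma psi_inj b s t : complete_geodesic d b -> psi X d' b s = psi X d' b t -> s = t.
Proof.
intros Hb E. destruct (Rtotal_order s t) as [L|[L|L]]; [|assumption|];
  apply (psi_incr b _ _ Hb) in L; lra.
Qed.

(** By [psi_rev], the Busemann functions of both ends are transformed by the same injective [psi],
    so opposite values correspond to opposite values. *)
Lemma flat_transfer b x : complete_geodesic d b -> (flat d b x <-> flat d' b x).
Proof.
destruct HN as (Hm & Hc & Hl & Hg). destruct HN' as (Hm' & Hc' & Hl' & Hg').
intros Hb. unfold flat.
rewrite (bus_transform b x Hb), (bus_transform (reversed b) x (complete_geodesic_rev X d b Hb)).
rewrite (psi_rev X d' Hm' Hc') by now apply geodesic_pgeod_transfer.
rewrite !Ropp_involutive. split; intros E.
- replace (- bus X d b x) with (bus X d (reversed b) x) by lra. ring.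
- assert (- bus X d b x = bus X d (reversed b) x); [|lra].
  apply (psi_inj b); [assumption|lra].
Qed.

(** As for Busemann functions: the infimum of [endpair] is negative when some distance is less than
    [2 k], which both metrics detect. Comparing the boundary curves of these conditions in the
    [(s, t)] plane relates the two parameter changes. *)
Lemma end_transfer b c M : complete_geodesic d b -> complete_geodesic d c ->
  (forall k, M <= endpair X d b c 0 0 k) ->
  exists C, forall s,
    psi X d' c (s - infn (endpair X d b c 0 0)) = psi X d' b s + C.
Proof.
destruct HN as (Hm & Hc & Hl & Hg). destruct HN' as (Hm' & Hc' & Hl' & Hg').
intros Hb Hcc HM.
assert (HM' : forall k, M - 1 <= endpair X d' b c 0 0 k).
{ intros k. specialize (HM k). unfold endpair in *.
  pose proof (dist_diff_le X d' d Hm' Hc' Hm (fun x y => iff_sym (H1 x y))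
    (b (0 - INR k)) (c (0 + INR k))). lra. }
set (H0 := infn (endpair X d b c 0 0)). set (H0' := infn (endpair X d' b c 0 0)).
assert (E : forall s t, H0 - s + t < 0 <-> H0' - psi X d' b s + psi X d' c t < 0).
{ intros s t.
  pose proof (is_inf_neg _ _ (endpair_shift X d Hm Hc b c M s t
    (geodesic_pgeod _ _ _ Hb) (geodesic_pgeod _ _ _ Hcc) HM)) as A.
  pose proof (is_inf_neg _ _ (endpair_shift X d' Hm' Hc' b c (M - 1) s t
    (geodesic_pgeod_transfer _ Hb) (geodesic_pgeod_transfer _ Hcc) HM')) as B.
  rewrite !(psi_geodesic X d Hm) in A by assumption.
  fold H0 in A. fold H0' in B. rewrite A, B. unfold endpair.
  split; intros [k Hk]; exists k.
  - assert (d' (b (s - INR k)) (c (t + INR k)) < INR (k + k)).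
    { apply lt_nat_iff. rewrite plus_INR. lra. }
    rewrite plus_INR in *. lra.
  - assert (d (b (s - INR k)) (c (t + INR k)) < INR (k + k)).
    { apply lt_nat_iff. rewrite plus_INR. lra. }
    rewrite plus_INR in *. lra. }
exists (- H0'). intros s. apply Rle_antisym.
- apply Rle_add_eps. intros e He.
  destruct (psi_cont c (s - H0) e Hcc He) as [del [Hdel K]].
  specialize (K (s - H0 - del / 2)).
  rewrite Rabs_right in K by lra. specialize (K ltac:(lra)). apply Rabs_def2 in K.
  assert (H0 - s + (s - H0 - del / 2) < 0) as L by lra. apply E in L. lra.
- apply Rnot_lt_le. intros C.
  assert (H0' - psi X d' b s + psi X d' c (s - H0) < 0) as L by lra. apply E in L. lra.
Qed.

(* The [d']-line [c] through the points [b i] consists of [d']-flat points,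
   which are [d]-flat, hence on [b]. *)
Lemma flat_free_dist b s t : complete_geodesic d b -> flat_free d b ->
  d' (b s) (b t) = Rabs (psi X d' b s - psi X d' b t).
Proof.
destruct HN as (Hm & Hc & Hl & Hg). destruct HN' as (Hm' & Hc' & Hl' & Hg').
intros Hb Hff. pose proof (geodesic_pgeod_transfer b Hb) as Hp.
destruct (line_through_integers X d' b Hm' (proj1 Hc') (proj1 Hp)) as [c [Hcc Hci]].
assert (E : forall x, bus X d' c x = bus X d' b x /\ bus X d' (reversed c) x = bus X d' (reversed b) x).
{ intros x. split; apply bus_ext; intros n.
  - rewrite INR_IZR_INZ. apply Hci.
  - unfold reversed. rewrite INR_IZR_INZ, <- opp_IZR. apply Hci. }
assert (F : forall s, b s = c (psi X d' b s)).
{ clear s t. intros s. set (th := psi X d' b s).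
  assert (E1 : bus X d' b (c th) = - th).
  { rewrite <- (proj1 (E _)). pose proof (psi_geodesic X d' Hm' c th Hcc) as K.
    unfold psi in K. lra. }
  assert (Fl : flat d' b (c th)).
  { unfold flat. rewrite E1, <- (proj2 (E _)), (bus_rev_on_line X d' Hm' Hc')
      by now apply geodesic_pgeod.
    rewrite (psi_geodesic X d' Hm') by assumption. ring. }
  apply (flat_transfer b _ Hb) in Fl. destruct (Hff _ Fl) as [t Ht].
  rewrite Ht in E1 |- *. f_equal. apply (psi_inj b); [assumption|].
  unfold th, psi in *. lra. }
rewrite (F s), (F t). apply Hcc.
Qed.

End Transfer.

(** * Flat strips *)

Section Strip.
Variables (X : Type) (d : X -> X -> R).
Hypotheses (Hm : is_metric d) (Hc : CAT0 d).

Lemma btw_line b s t l : complete_geodesic d b -> 0 <= l <= 1 ->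
  btw X d (b s) (b t) l (b ((1 - l) * s + l * t)).
Proof.
intros Hb Hl. split; rewrite !Hb.
- replace (s - ((1 - l) * s + l * t)) with (l * (s - t)) by ring.
  rewrite Rabs_mult, (Rabs_right l) by lra. ring.
- replace ((1 - l) * s + l * t - t) with ((1 - l) * (s - t)) by ring.
  rewrite Rabs_mult, (Rabs_right (1 - l)) by lra. ring.
Qed.

(** In the Euclidean plane [d p (b t) ^ 2 - t ^ 2] is affine in [t]; CAT(0) makes it convex. *)
Lemma sqdist_line_convex b p s t l : complete_geodesic d b -> 0 <= l <= 1 ->
  d p (b ((1 - l) * s + l * t)) ^ 2 - ((1 - l) * s + l * t) ^ 2 <=
  (1 - l) * (d p (b s) ^ 2 - s ^ 2) + l * (d p (b t) ^ 2 - t ^ 2).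
Proof.
intros Hb Hl.
pose proof (btw_comparison X d Hm Hc _ _ _ _ p Hl (btw_line b s t l Hb Hl)) as K.
rewrite Hb, pow2_abs in K. lra.
Qed.

Lemma bus_of_pythagoras b p x h : complete_geodesic d b ->
  (forall s, d p (b s) ^ 2 = (x - s) ^ 2 + h ^ 2) -> bus X d b p = - x.
Proof.
intros Hb H.
apply is_inf_unique with (f := fun n => d p (b (INR n)) - INR n).
- apply bus_is_inf; [assumption|]. now apply geodesic_pgeod.
- split.
  + intros n. enough (INR n - x <= d p (b (INR n))) by lra.
    apply Rsqr_le_cancel; [now apply metric_pos|]. rewrite H.
    pose proof (pow2_ge_0 h). lra.
  + intros e He. destruct (nat_above (Rabs x + h ^ 2 / e)) as [n Hn].
    exists n. pose proof (Rle_abs x). pose proof (pow2_ge_0 h) as Hh.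
    assert (0 <= h ^ 2 / e) by (apply Rmult_le_pos; [assumption|apply Rlt_le, Rinv_0_lt_compat; lra]).
    assert (Hx : h ^ 2 / e < INR n - x) by lra.
    assert (h ^ 2 < (INR n - x) * e).
    { apply Rmult_lt_compat_r with (r := e) in Hx; [|lra].
      unfold Rdiv in Hx. rewrite Rmult_assoc, Rinv_l in Hx by lra. lra. }
    enough (d p (b (INR n)) < INR n - x + e) by lra.
    apply Rnot_le_lt. intros C.
    assert ((INR n - x + e) ^ 2 <= d p (b (INR n)) ^ 2) as C2 by (apply pow_incr; lra).
    rewrite H in C2. nra.
Qed.

(** The convex function [d g (b t) ^ 2 - t ^ 2] grows sublinearly, because [d g (b n) - n] tends to
    0; so it stays below its value at 0. *)
Lemma flat_half_bound b g s : complete_geodesic d b -> bus X d b g = 0 -> 0 <= s ->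
  d g (b s) ^ 2 <= d g (b 0) ^ 2 + s ^ 2.
Proof.
intros Hb H0 Hs.
pose proof (geodesic_pgeod X d b Hb) as Hp.
pose proof (bus_is_inf X d Hm b g Hp) as I. rewrite H0 in I.
apply Rle_add_eps. intros e He.
(* At [n] the convex function is at most [3 n e']; the weight [s / n] reduces this to [3 s e'],
   which is less than [e]. *)
set (e' := Rmin 1 (e / (4 * (s + 1)))).
assert (He' : 0 < e' /\ e' <= 1 /\ e' * (s + 1) <= e / 4).
{ assert (A : 0 < e / (4 * (s + 1))) by (apply Rdiv_lt_0_compat; lra).
  unfold e'. split; [apply Rmin_pos; lra|]. split; [apply Rmin_l|].
  eapply Rle_trans; [apply Rmult_le_compat_r; [lra|apply Rmin_r]|].
  apply Req_le. field. lra. }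
destruct (is_inf_eventually _ _ e' (bus_decr0 X d Hm b g Hp) I (proj1 He')) as [N HN].
destruct (nat_above (s + 1)) as [M HM].
set (n := (N + M)%nat). specialize (HN n ltac:(unfold n; lia)). cbv beta in HN.
assert (Hn : s + 1 < INR n).
{ unfold n. rewrite plus_INR. pose proof (pos_INR N). lra. }
pose proof (proj1 I n) as Hn2. cbv beta in Hn2.
assert (L : 0 <= s / INR n <= 1).
{ split; [apply Rmult_le_pos; [lra|apply Rlt_le, Rinv_0_lt_compat; lra]|].
  apply Rmult_le_reg_r with (INR n); [lra|]. unfold Rdiv.
  rewrite Rmult_assoc, Rinv_l; lra. }
pose proof (sqdist_line_convex b g 0 (INR n) (s / INR n) Hb L) as K.
replace ((1 - s / INR n) * 0 + s / INR n * INR n) with s in K by (field; lra).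
assert (A : d g (b (INR n)) ^ 2 - INR n ^ 2 <= e' * (3 * INR n)) by nra.
assert (B : s / INR n * (d g (b (INR n)) ^ 2 - INR n ^ 2) <= 3 * s * e').
{ eapply Rle_trans; [apply Rmult_le_compat_l; [lra|exact A]|].
  apply Req_le. field. lra. }
pose proof (pow2_ge_0 (d g (b 0))).
assert (0 <= s / INR n * d g (b 0) ^ 2) by (apply Rmult_le_pos; lra).
nra.
Qed.

(** The upper bound holds at [s] and [- s]; convexity at their midpoint 0 leaves no room for strict
    inequality. *)
Lemma flat_pythagoras b g s : complete_geodesic d b ->
  bus X d b g = 0 -> bus X d (reversed b) g = 0 ->
  d g (b s) ^ 2 = d g (b 0) ^ 2 + s ^ 2.
Proof.
intros Hb H1 H2.
assert (U : forall s, d g (b s) ^ 2 <= d g (b 0) ^ 2 + s ^ 2).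
{ intros t. destruct (Rle_lt_dec 0 t) as [L|L].
  - now apply flat_half_bound.
  - pose proof (flat_half_bound (reversed b) g (- t) (complete_geodesic_rev X d b Hb) H2
      ltac:(lra)) as K.
    unfold reversed in K. rewrite Ropp_involutive, Ropp_0 in K.
    replace ((- t) ^ 2) with (t ^ 2) in K by ring. exact K. }
pose proof (sqdist_line_convex b g s (- s) (1 / 2) Hb ltac:(lra)) as K.
replace ((1 - 1 / 2) * s + 1 / 2 * - s) with 0 in K by field.
pose proof (U s). pose proof (U (- s)). nra.
Qed.

(* The strip is foliated by the segments from [g] to the line: the point with
   coordinates [(x, y)] divides the segment from [b S] to [g] in the ratio [y : r - y],
   where [x = (1 - y / r) S]. *)
Lemma strip_exists0 b g : complete_geodesic d b ->
  bus X d b g = 0 -> bus X d (reversed b) g = 0 -> g <> b 0 ->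
  exists w F, 0 < w /\ (forall x, F x 0 = b x) /\
    (forall x1 y1 x2 y2, 0 <= y1 <= w -> 0 <= y2 <= w ->
       d (F x1 y1) (F x2 y2) ^ 2 = (x1 - x2) ^ 2 + (y1 - y2) ^ 2).
Proof.
intros Hb H1 H2 Hg.
pose proof (fun s => flat_pythagoras b g s Hb H1 H2) as P.
set (r := d g (b 0)) in *.
assert (Hr : 0 < r).
{ destruct (metric_pos X d Hm g (b 0)) as [|Z]; [assumption|].
  symmetry in Z. now apply metric_eq in Z. }
set (F := fun x y => epsilon (inhabits g) (btw X d (b (x / (1 - y / r))) g (y / r))).
(* Half the height keeps [1 - y / r] away from 0. *)
set (w := r / 2).
assert (Hyr : forall y, 0 <= y <= w -> 0 <= y / r <= 1 / 2).
{ unfold w. intros y Hy. split.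
  - apply Rmult_le_pos; [lra|]. apply Rlt_le, Rinv_0_lt_compat; lra.
  - apply Rmult_le_reg_r with r; [lra|]. unfold Rdiv.
    rewrite Rmult_assoc, Rinv_l by lra. lra. }
assert (HF : forall x y, 0 <= y <= w -> btw X d (b (x / (1 - y / r))) g (y / r) (F x y)).
{ intros x y Hy. apply epsilon_spec. apply btw_exists; try assumption.
  specialize (Hyr y Hy). lra. }
(* Comparison gives the upper bound everywhere and [btw] gives equality at [S]; convexity on
   intervals centred at [S] then forces equality everywhere. *)
assert (Hax : forall x y s, 0 <= y <= w -> d (F x y) (b s) ^ 2 = (x - s) ^ 2 + y ^ 2).
{ intros x y s Hy. specialize (HF x y Hy). specialize (Hyr y Hy).
  set (l := y / r) in *. set (S := x / (1 - l)) in *. set (p := F x y) in *.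
  assert (Ey : y = l * r) by (unfold l; field; lra).
  assert (Ex : x = (1 - l) * S) by (unfold S; field; lra).
  assert (U : forall t, d p (b t) ^ 2 <= (x - t) ^ 2 + y ^ 2).
  { intros t.
    pose proof (btw_comparison X d Hm Hc _ _ l p (b t) ltac:(lra) HF) as K.
    rewrite (metric_sym X d Hm (b t) p), (metric_sym X d Hm (b t) g),
      (metric_sym X d Hm (b S) g), (P S), (P t), Hb, pow2_abs in K.
    eapply Rle_trans; [exact K|]. rewrite Ex, Ey. apply Req_le. ring. }
  assert (ES : d p (b S) ^ 2 = (x - S) ^ 2 + y ^ 2).
  { rewrite (metric_sym X d Hm p), (proj1 HF), (metric_sym X d Hm (b S) g), Rpow_mult_distr, P.
    rewrite Ey, Ex. ring. }
  pose proof (sqdist_line_convex b p s (2 * S - s) (1 / 2) Hb ltac:(lra)) as K.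
  replace ((1 - 1 / 2) * s + 1 / 2 * (2 * S - s)) with S in K by field.
  rewrite ES in K. pose proof (U s). pose proof (U (2 * S - s)). nra. }
assert (HU : forall x1 y1 x2 y2, 0 <= y1 <= w -> 0 <= y2 <= w ->
  d (F x1 y1) (F x2 y2) ^ 2 <= (x1 - x2) ^ 2 + (y1 - y2) ^ 2).
{ intros x1 y1 x2 y2 Hy1 Hy2.
  pose proof (HF x1 y1 Hy1) as B1. pose proof (HF x2 y2 Hy2) as B2.
  pose proof (Hyr y1 Hy1). pose proof (Hyr y2 Hy2).
  set (l1 := y1 / r) in *. set (l2 := y2 / r) in *.
  set (S1 := x1 / (1 - l1)) in *. set (S2 := x2 / (1 - l2)) in *.
  apply btw_sym in B1; [|assumption]. apply btw_sym in B2; [|assumption].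
  pose proof (btw_two_sides X d Hm Hc g (b S1) (b S2) (1 - l1) (1 - l2) _ _ ltac:(lra) ltac:(lra) B1 B2) as K.
  rewrite (P S1), (P S2), Hb, pow2_abs in K.
  eapply Rle_trans; [exact K|]. apply Req_le.
  replace y1 with (l1 * r) by (unfold l1; field; lra).
  replace y2 with (l2 * r) by (unfold l2; field; lra).
  replace x1 with ((1 - l1) * S1) by (unfold S1; field; lra).
  replace x2 with ((1 - l2) * S2) by (unfold S2; field; lra). ring. }
(* The planar line through the two points meets the axis at [s]. The distances to [b s] are known,
   and their difference bounds the distance of the two points from below. *)
assert (HL : forall x1 y1 x2 y2, 0 <= y1 <= w -> 0 <= y2 <= w -> y1 <> y2 ->
  (x1 - x2) ^ 2 + (y1 - y2) ^ 2 <= d (F x1 y1) (F x2 y2) ^ 2).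
{ intros x1 y1 x2 y2 Hy1 Hy2 Hne.
  set (m := (x2 - x1) / (y2 - y1)).
  assert (Em : x2 - x1 = m * (y2 - y1)) by (unfold m; field; lra).
  set (s := x1 - y1 * m). set (k := sqrt (1 + m ^ 2)).
  assert (Hk : k ^ 2 = 1 + m ^ 2).
  { unfold k. apply pow2_sqrt. pose proof (pow2_ge_0 m). lra. }
  assert (Hk0 : 0 <= k) by apply sqrt_pos.
  assert (A : forall y x, 0 <= y <= w -> x - s = y * m -> d (F x y) (b s) = y * k).
  { intros y x Hy Hx. pose proof (Hax x y s Hy) as E. rewrite Hx in E.
    pose proof (metric_pos X d Hm (F x y) (b s)).
    assert (0 <= y * k) by (apply Rmult_le_pos; lra).
    apply Rle_antisym; apply Rsqr_le_cancel; try assumption; rewrite E; nra. }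
  pose proof (A y1 x1 Hy1 ltac:(unfold s; ring)) as A1.
  pose proof (A y2 x2 Hy2 ltac:(unfold s; nra)) as A2.
  pose proof (metric_lip X d Hm (F x1 y1) (F x2 y2) (b s)) as L.
  rewrite A1, A2 in L.
  assert (L2 : Rabs (y1 * k - y2 * k) ^ 2 <= d (F x1 y1) (F x2 y2) ^ 2).
  { apply pow_incr. split; [apply Rabs_pos|exact L]. }
  rewrite pow2_abs in L2.
  replace ((x1 - x2) ^ 2) with ((m * (y2 - y1)) ^ 2) by (rewrite <- Em; ring).
  nra. }
exists w, F. split; [unfold w; lra|]. split.
- intros x. assert (H0 : 0 <= 0 <= w) by (unfold w; lra).
  pose proof (HF x 0 H0) as [B _].
  symmetry. apply (metric_eq X d Hm).
  replace (0 / r) with 0 in B by (field; lra).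
  replace (x / (1 - 0)) with x in B by field. rewrite B. ring.
- intros x1 y1 x2 y2 Hy1 Hy2. apply Rle_antisym; [now apply HU|].
  (* At equal heights that line does not meet the axis; one height is perturbed by less than [e]. *)
  destruct (Req_dec y1 y2) as [<-|Hne]; [|now apply HL].
  replace ((x1 - x2) ^ 2 + (y1 - y1) ^ 2) with (Rabs (x1 - x2) ^ 2)
    by (rewrite pow2_abs; ring).
  apply pow_incr. split; [apply Rabs_pos|].
  apply Rle_add_eps. intros e He.
  assert (exists y, 0 <= y <= w /\ y1 <> y /\ (y1 - y) ^ 2 < e ^ 2) as (y & Hy & Hne & Hye).
  { set (h := Rmin (w / 2) (e / 2)).
    assert (0 < h /\ h <= w / 2 /\ h <= e / 2).
    { unfold h. split; [apply Rmin_pos; unfold w; lra|]. split; [apply Rmin_l|apply Rmin_r]. }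
    destruct (Rle_lt_dec y1 (w / 2)).
    - exists (y1 + h). repeat split; try lra. nra.
    - exists (y1 - h). repeat split; try lra. nra. }
  pose proof (HL x1 y1 x2 y Hy1 Hy Hne) as L1.
  pose proof (HU x2 y x2 y1 Hy Hy1) as U1.
  pose proof (metric_tri X d Hm (F x2 y1) (F x1 y1) (F x2 y)) as T.
  rewrite (metric_sym X d Hm (F x2 y1) (F x2 y)) in T.
  assert (Rabs (x1 - x2) <= d (F x1 y1) (F x2 y)).
  { apply Rsqr_le_cancel; [now apply metric_pos|]. rewrite pow2_abs.
    pose proof (pow2_ge_0 (y1 - y)). lra. }
  assert (d (F x2 y) (F x2 y1) < e).
  { apply Rnot_le_lt. intros C.
    assert (e ^ 2 <= d (F x2 y) (F x2 y1) ^ 2) by (apply pow_incr; lra). nra. }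
  lra.
Qed.

Lemma strip_exists b : complete_geodesic d b -> ~ flat_free d b ->
  exists w F, 0 < w /\ (forall x, F x 0 = b x) /\
    (forall x1 y1 x2 y2, 0 <= y1 <= w -> 0 <= y2 <= w ->
       d (F x1 y1) (F x2 y2) ^ 2 = (x1 - x2) ^ 2 + (y1 - y2) ^ 2).
Proof.
intros Hb Hff.
assert (exists g, flat d b g /\ forall s, g <> b s) as [g [Hg1 Hg2]].
{ apply NNPP. intros C. apply Hff. intros g Hg. apply NNPP. intros C2. apply C.
  exists g. split; [assumption|]. intros s E. apply C2. now exists s. }
unfold flat in Hg1. set (th := - bus X d b g).
set (c := fun t => b (t + th)).
assert (Hcg : complete_geodesic d c).
{ intros s t. unfold c. rewrite Hb. f_equal. ring. }
pose proof (geodesic_pgeod X d b Hb) as Hp.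
destruct (strip_exists0 c g Hcg) as (w & F & Hw & F0 & HF).
- apply is_inf_unique with (f := fun n => d g (c (INR n)) - INR n).
  + apply bus_is_inf; [assumption|]. now apply geodesic_pgeod.
  + pose proof (bus_shift X d Hm Hc b g th Hp) as I.
    rewrite (psi_geodesic X d Hm) in I by assumption. unfold th at 2 in I.
    rewrite Rplus_opp_r in I. unfold c.
    split; intros; [rewrite Rplus_comm|destruct (proj2 I e H) as [n Hn]; exists n;
      rewrite Rplus_comm]; [apply I|assumption].
- apply is_inf_unique with (f := fun n => d g (reversed c (INR n)) - INR n).
  + apply bus_is_inf; [assumption|]. now apply geodesic_pgeod, complete_geodesic_rev.
  + pose proof (bus_shift X d Hm Hc (reversed b) g (- th) (pgeod_rev X d Hm b Hp)) as I.
    rewrite (psi_geodesic X d Hm) in I by now apply complete_geodesic_rev.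
    replace (bus X d (reversed b) g + - th) with 0 in I by (unfold th; lra).
    assert (E : forall n, reversed c (INR n) = reversed b (- th + INR n)).
    { intros n. unfold reversed, c. f_equal. ring. }
    split; intros; [rewrite E; apply I|].
    destruct (proj2 I e H) as [n Hn]. exists n. now rewrite E.
- apply Hg2.
- exists w, (fun x y => F (x - th) y). split; [assumption|]. split.
  + intros x. rewrite F0. unfold c. f_equal. ring.
  + intros. rewrite HF by assumption. ring.
Qed.

Lemma strip_boundary b : complete_geodesic d b -> ~ flat_free d b ->
  boundary_line_of_strip d b.
Proof.
intros Hb Hff. destruct (strip_exists b Hb Hff) as (w & F & Hw & F0 & HF).
exists w, F. split; [assumption|]. split.
- intros x1 y1 x2 y2 Hy1 Hy2. rewrite <- HF by assumption.
  now rewrite sqrt_pow2 by now apply metric_pos.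
- left. intros p. split; intros [t ->]; exists t; now rewrite F0.
Qed.

Lemma bus_convex b x y l m : pgeod X d b -> 0 <= l <= 1 -> btw X d x y l m ->
  bus X d b m <= (1 - l) * bus X d b x + l * bus X d b y.
Proof.
intros Hp Hl B. apply Rle_add_eps. intros e He.
destruct (is_inf_eventually _ _ e (bus_decr0 X d Hm b x Hp) (bus_is_inf X d Hm b x Hp) He)
  as [N1 H1].
destruct (is_inf_eventually _ _ e (bus_decr0 X d Hm b y Hp) (bus_is_inf X d Hm b y Hp) He)
  as [N2 H2].
set (n := (N1 + N2)%nat).
specialize (H1 n ltac:(unfold n; lia)). specialize (H2 n ltac:(unfold n; lia)).
cbv beta in H1, H2.
pose proof (proj1 (bus_is_inf X d Hm b m Hp) n) as H3. cbv beta in H3.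
pose proof (btw_convex_point X d Hm Hc _ _ _ _ (b (INR n)) Hl B).
destruct (Rle_lt_or_eq_dec 0 l (proj1 Hl)); [|subst l; lra]. nra.
Qed.

End Strip.

(** * Periods *)

Definition period (f : R -> R) (tau : R) : Prop := forall s, f (s + tau) = f s + tau.

Definition unit_increasing (f : R -> R) : Prop :=
  period f 1 /\ forall s t, s < t -> f s < f t.

Lemma period_nat f tau n s : period f tau -> f (s + INR n * tau) = f s + INR n * tau.
Proof.
intros H. induction n as [|n IH].
- simpl. now rewrite Rmult_0_l, !Rplus_0_r.
- rewrite S_INR. replace (s + (INR n + 1) * tau) with (s + INR n * tau + tau) by ring.
  rewrite H, IH. ring.
Qed.

(** At unit steps from [s] the function is a translation, and it is monotone in between. *)
Lemma unit_increasing_near f s x : unit_increasing f -> s <= x -> Rabs (f x - f s - (x - s)) <= 1.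
Proof.
intros [H1 H2] Hx.
assert (HI : forall s t, s <= t -> f s <= f t).
{ intros a b [L| ->]; [apply Rlt_le; now apply H2|lra]. }
destruct (archimed (x - s)) as [A B].
assert (P : (0 <= up (x - s) - 1)%Z).
{ assert (0 < up (x - s))%Z; [apply lt_IZR; lra|lia]. }
set (n := Z.to_nat (up (x - s) - 1)).
assert (En : INR n = IZR (up (x - s)) - 1).
{ unfold n. rewrite INR_IZR_INZ, Z2Nat.id, minus_IZR by assumption. ring. }
pose proof (period_nat f 1 n s H1) as E1. pose proof (period_nat f 1 (S n) s H1) as E2.
rewrite Rmult_1_r in E1. rewrite Rmult_1_r, S_INR in E2.
pose proof (HI (s + INR n) x ltac:(lra)). pose proof (HI x (s + (INR n + 1)) ltac:(lra)).
apply Rabs_le. lra.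
Qed.

(** Otherwise the deviation [n (C - tau)] from a translation would be unbounded. *)
Lemma progression_step f s tau C : unit_increasing f -> 0 <= tau ->
  (forall n, f (s + INR n * tau) = f s + INR n * C) -> C = tau.
Proof.
intros Hf Ht H. apply NNPP. intros Hne.
assert (P : 0 < Rabs (C - tau)) by (apply Rabs_pos_lt; lra).
destruct (nat_above (/ Rabs (C - tau))) as [n Hn].
apply Rmult_lt_compat_r with (r := Rabs (C - tau)) in Hn; [|assumption].
rewrite Rinv_l in Hn by lra.
assert (0 <= INR n * tau) by (apply Rmult_le_pos; [apply pos_INR|assumption]).
pose proof (unit_increasing_near f s (s + INR n * tau) Hf ltac:(lra)) as K.
rewrite H in K.
replace (f s + INR n * C - f s - (s + INR n * tau - s)) with (INR n * (C - tau)) in K by ring.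
rewrite Rabs_mult, (Rabs_right (INR n)) in K by (pose proof (pos_INR n); lra). lra.
Qed.

Lemma translation_period f tau C : unit_increasing f -> 0 <= tau ->
  (forall s, f (s + tau) = f s + C) -> period f tau.
Proof.
intros Hf Ht H. assert (C = tau) as <-; [|exact H].
apply (progression_step f 0 tau C Hf Ht). induction n as [|n IH].
- simpl. now rewrite !Rmult_0_l, !Rplus_0_r.
- rewrite S_INR. replace (0 + (INR n + 1) * tau) with (0 + INR n * tau + tau) by ring.
  rewrite H, IH. ring.
Qed.

Lemma period_shift f g h C tau : (forall s, g s = f (s + h) + C) -> period g tau -> period f tau.
Proof.
intros E H s. specialize (H (s - h)). rewrite !E in H.
replace (s - h + tau + h) with (s + tau) in H by ring.
replace (s - h + h) with s in H by ring. lra.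
Qed.

(** Since [f] fixes the nonnegative multiples of a period [tau], monotonicity moves no nonnegative
    point by [tau] or more. Unit translations reach the negative points. *)
Lemma small_periods_identity f : unit_increasing f -> f 0 = 0 ->
  (forall k, 0 < k -> exists tau, 0 < tau < k /\ period f tau) -> forall s, f s = s.
Proof.
intros Hf H0 Hper.
assert (Pos : forall s, 0 <= s -> f s = s).
{ intros s Hs. apply cond_eq. intros e He.
  destruct (Hper e He) as [tau [Ht Hp]].
  destruct (archimed (s / tau)) as [A B].
  assert (0 <= s / tau) by (apply Rmult_le_pos; [lra|apply Rlt_le, Rinv_0_lt_compat; lra]).
  assert (P : (0 <= up (s / tau) - 1)%Z).
  { assert (0 < up (s / tau))%Z; [apply lt_IZR; lra|lia]. }
  set (n := Z.to_nat (up (s / tau) - 1)).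
  assert (En : INR n = IZR (up (s / tau)) - 1).
  { unfold n. rewrite INR_IZR_INZ, Z2Nat.id, minus_IZR by assumption. ring. }
  assert (Es : s = s / tau * tau) by (field; lra).
  assert (L1 : INR n * tau <= s) by (rewrite Es at 1; apply Rmult_le_compat_r; lra).
  assert (L2 : s < (INR n + 1) * tau) by (rewrite Es at 1; apply Rmult_lt_compat_r; lra).
  pose proof (period_nat f tau n 0 Hp) as E1. pose proof (period_nat f tau (S n) 0 Hp) as E2.
  rewrite S_INR in E2. rewrite H0, !Rplus_0_l in E1, E2.
  destruct Hf as [_ HI]. pose proof (HI s _ L2) as K2.
  assert (K1 : INR n * tau <= f s).
  { destruct L1 as [L|L]; [apply HI in L; lra|rewrite <- L; lra]. }
  apply Rabs_def1; lra. }
intros s. destruct (Rle_lt_dec 0 s) as [L|L]; [now apply Pos|].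
destruct (nat_above (- s)) as [n Hn].
pose proof (period_nat f 1 n s (proj1 Hf)) as E. rewrite Rmult_1_r in E.
rewrite Pos in E by lra. lra.
Qed.

Section PeriodTransfer.
Variables (X : Type) (d d' : X -> X -> R).
Hypotheses (HN : nice d) (HN' : nice d')
  (H1 : forall x y, d x y <= 1 <-> d' x y <= 1).

Lemma psi_unit_increasing b : complete_geodesic d b -> unit_increasing (psi X d' b).
Proof.
intros Hb. split.
- intros s. apply psi_unit; try apply HN'. now apply (geodesic_pgeod_transfer X d d').
- intros s t. now apply (psi_incr X d d').
Qed.

(* Three points at distances [1, 1, 2] on an oblique segment of a strip around [b] are
   also [d']-collinear, so their Busemann coordinates are in arithmetic progression. *)
Lemma strip_period b : complete_geodesic d b -> ~ flat_free d b ->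
  exists k, 0 < k /\ forall tau, 0 < tau < k -> period (psi X d' b) tau.
Proof.
intros Hb Hff.
destruct HN as (Hm & Hc & Hl & Hg). destruct HN' as (Hm' & Hc' & Hl' & Hg').
destruct (strip_exists X d Hm Hc b Hb Hff) as (w & F & Hw & F0 & HF).
pose proof (geodesic_pgeod_transfer X d d' HN HN' H1 b Hb) as Hp.
assert (Hbus : forall x y, 0 <= y <= w ->
  bus X d' b (F x y) = - psi X d' b x /\ bus X d' (reversed b) (F x y) = psi X d' b x).
{ intros x y Hy. split.
  - rewrite (bus_transform X d d' HN HN' H1 b) by assumption.
    rewrite (bus_of_pythagoras X d Hm b (F x y) x y Hb); [now rewrite Ropp_involutive|].
    intros s. rewrite <- F0, HF by lra. ring.
  - rewrite (bus_transform X d d' HN HN' H1 (reversed b)) by now apply complete_geodesic_rev.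
    rewrite (bus_of_pythagoras X d Hm (reversed b) (F x y) (- x) y).
    + rewrite (psi_rev X d' Hm' Hc') by assumption. now rewrite !Ropp_involutive.
    + now apply complete_geodesic_rev.
    + intros s. unfold reversed. rewrite <- F0, HF by lra. ring. }
(* The vector [(1 - tau, h)] has length 1, and the bound [w ^ 2 / 8] gives [2 h <= w], so that two
   such steps stay in the strip. *)
exists (Rmin 1 (w ^ 2 / 8)). split; [apply Rmin_pos; [lra|]; nra|].
intros tau Ht. pose proof (Rmin_l 1 (w ^ 2 / 8)). pose proof (Rmin_r 1 (w ^ 2 / 8)).
set (h := sqrt (2 * tau - tau ^ 2)).
assert (Hh : h ^ 2 = 2 * tau - tau ^ 2) by (apply pow2_sqrt; nra).
assert (Hh0 : 0 <= h) by apply sqrt_pos.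
assert (Hhw : h <= w / 2) by (apply Rsqr_le_cancel; nra).
assert (Mid : forall s, psi X d' b (s - tau) + psi X d' b (s - tau) =
                        psi X d' b s + psi X d' b (s - tau - tau)).
{ intros s. set (c := 1 - tau).
  set (p0 := F s 0). set (p1 := F (s + c) h). set (p2 := F (s + 2 * c) (2 * h)).
  assert (Sq : forall n x y, d x y ^ 2 = INR n ^ 2 -> d' x y = INR n).
  { intros n x y E. apply (eq_nat_transfer X d d'); try assumption.
    pose proof (metric_pos X d Hm x y). pose proof (pos_INR n).
    apply Rle_antisym; apply Rsqr_le_cancel; lra. }
  assert (D1 : d' p0 p1 = INR 1).
  { apply Sq. unfold p0, p1, c. rewrite HF by lra. simpl. nra. }
  assert (D2 : d' p1 p2 = INR 1).
  { apply Sq. unfold p1, p2, c. rewrite HF by lra. simpl. nra. }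
  assert (D3 : d' p0 p2 = INR 2).
  { apply Sq. unfold p0, p2, c. rewrite HF by lra. simpl. nra. }
  simpl in D1, D2, D3.
  assert (B : btw X d' p0 p2 (1 / 2) p1) by (split; lra).
  (* The two Busemann functions are convex and opposite on the strip, so both are affine at the
     midpoint [p1]. *)
  pose proof (bus_convex X d' Hm' Hc' b p0 p2 (1 / 2) p1 Hp ltac:(lra) B) as K1.
  pose proof (bus_convex X d' Hm' Hc' (reversed b) p0 p2 (1 / 2) p1 (pgeod_rev X d' Hm' b Hp) ltac:(lra) B) as K2.
  destruct (Hbus s 0 ltac:(lra)) as [A1 A2].
  destruct (Hbus (s + c) h ltac:(lra)) as [A3 A4].
  destruct (Hbus (s + 2 * c) (2 * h) ltac:(lra)) as [A5 A6].
  fold p0 in A1, A2. fold p1 in A3, A4. fold p2 in A5, A6.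
  rewrite A1, A3, A5 in K1. rewrite A2, A4, A6 in K2.
  pose proof (proj1 (psi_unit_increasing b Hb)) as U.
  assert (E1 : psi X d' b (s + c) = psi X d' b (s - tau) + 1).
  { rewrite <- U. f_equal. unfold c. ring. }
  assert (E2 : psi X d' b (s + 2 * c) = psi X d' b (s - tau - tau) + 1 + 1).
  { rewrite <- !U. f_equal. unfold c. ring. }
  lra. }
intros s.
assert (Pr : forall n, psi X d' b (s + INR n * tau) =
  psi X d' b s + INR n * (psi X d' b (s + tau) - psi X d' b s) /\
  psi X d' b (s + INR (S n) * tau) =
  psi X d' b s + INR (S n) * (psi X d' b (s + tau) - psi X d' b s)).
{ induction n as [|n [IH1 IH2]].
  - simpl. rewrite !Rmult_0_l, !Rmult_1_l, !Rplus_0_r. split; ring.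
  - split; [assumption|]. rewrite !S_INR in *.
    specialize (Mid (s + (INR n + 1 + 1) * tau)).
    replace (s + (INR n + 1 + 1) * tau - tau) with (s + (INR n + 1) * tau) in Mid by ring.
    replace (s + (INR n + 1) * tau - tau) with (s + INR n * tau) in Mid by ring. lra. }
pose proof (progression_step _ s tau _ (psi_unit_increasing b Hb) ltac:(lra)
  (fun n => proj1 (Pr n))). lra.
Qed.

End PeriodTransfer.

(** * Continuous functions with countably many values *)

(** Cantor's nested intervals: the right half is kept if [v n] lies left of the midpoint, otherwise
    the left third, so that [v n] is outside the closed interval kept. *)
Fixpoint avoiding (v : nat -> R) (a b : R) (n : nat) : R * R :=
  match n with
  | O => (a, b)
  | S n => let (x, y) := avoiding v a b n in
           if Rlt_dec (v n) ((x + y) / 2) then ((x + y) / 2, y) else (x, (2 * x + y) / 3)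
  end.

Lemma sequence_misses_point (v : nat -> R) (a b : R) : a < b ->
  exists y, a <= y <= b /\ forall n, v n <> y.
Proof.
intros Hab. set (I := avoiding v a b).
assert (Hlt : forall n, fst (I n) < snd (I n)).
{ induction n as [|n IH]; [exact Hab|]. unfold I in *. simpl.
  destruct (avoiding v a b n) as [x y]. simpl in IH.
  destruct (Rlt_dec _ _); simpl; lra. }
assert (Hstep : forall n, fst (I n) <= fst (I (S n)) /\ snd (I (S n)) <= snd (I n) /\
  (v n < fst (I (S n)) \/ snd (I (S n)) < v n)).
{ intros n. specialize (Hlt n). unfold I in *. simpl.
  destruct (avoiding v a b n) as [x y]. simpl in *.
  destruct (Rlt_dec _ _); simpl; lra. }
assert (Hmono : forall n k, fst (I n) <= fst (I (n + k)%nat) /\ snd (I (n + k)%nat) <= snd (I n)).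
{ intros n; induction k as [|k IH]; [rewrite Nat.add_0_r; lra|].
  rewrite Nat.add_succ_r. pose proof (Hstep (n + k)%nat). lra. }
assert (Hcross : forall n m, fst (I n) <= snd (I m)).
{ intros n m. pose proof (Hmono n m) as A. pose proof (Hmono m n) as B.
  rewrite (Nat.add_comm m n) in B. pose proof (Hlt (n + m)%nat). lra. }
destruct (completeness (fun x => exists n, x = fst (I n))) as [y [Hy1 Hy2]].
- exists b. intros x [n ->]. exact (Hcross n 0%nat).
- exists a. now exists 0%nat.
- exists y.
  assert (L : forall n, fst (I n) <= y) by (intros n; apply Hy1; now exists n).
  assert (U : forall n, y <= snd (I n)) by (intros n; apply Hy2; intros x [k ->]; apply Hcross).
  split; [split; [exact (L 0%nat)|exact (U 0%nat)]|].
  intros n E. pose proof (Hstep n). pose proof (L (S n)). pose proof (U (S n)). lra.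
Qed.

(** Composition with this projection turns continuity relative to [[A, B]] into two-sided
    continuity, also at the endpoints, as [IVT_interv] asks. *)
Definition clamp (A B x : R) : R := Rmax A (Rmin B x).

Lemma clamp_in A B x : A <= B -> A <= clamp A B x <= B.
Proof.
intros H. unfold clamp, Rmax, Rmin.
repeat match goal with |- context [Rle_dec ?u ?v] => destruct (Rle_dec u v) end; lra.
Qed.

Lemma clamp_id A B x : A <= x <= B -> clamp A B x = x.
Proof.
intros H. unfold clamp. rewrite Rmin_right, Rmax_right; lra.
Qed.

Lemma clamp_lip A B x y : A <= B -> Rabs (clamp A B x - clamp A B y) <= Rabs (x - y).
Proof.
intros H. pose proof (Rle_abs (x - y)). pose proof (Rle_abs (- (x - y))) as L.
rewrite Rabs_Ropp in L. apply Rabs_le. unfold clamp, Rmax, Rmin.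
destruct (Rle_dec B x), (Rle_dec B y);
repeat match goal with |- context [Rle_dec ?u ?v] => destruct (Rle_dec u v) end; lra.
Qed.

Definition continuous_between (A B : R) (f : R -> R) : Prop :=
  forall u, A <= u <= B -> forall e, 0 < e -> exists del, 0 < del /\
    forall v, A <= v <= B -> Rabs (u - v) < del -> Rabs (f u - f v) < e.

Lemma intermediate_value A B f y : A <= B -> continuous_between A B f ->
  f A <= y <= f B -> exists u, A <= u <= B /\ f u = y.
Proof.
intros HAB Hf Hy.
destruct (Req_dec (f A) y) as [E|Ne1]; [exists A; split; [lra|assumption]|].
destruct (Req_dec (f B) y) as [E|Ne2]; [exists B; split; [lra|assumption]|].
assert (A < B) by (destruct HAB as [|E]; [assumption|subst B; lra]).
set (g := fun x => f (clamp A B x) - y).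
destruct (IVT_interv g A B) as [z [Hz1 Hz2]].
- intros x Hx. unfold continuity_pt, continue_in, limit1_in, limit_in. intros e He.
  destruct (Hf (clamp A B x) (clamp_in A B x HAB) e He) as [del [Hd K]].
  exists del. split; [assumption|]. intros x' [_ Hx']. simpl in *. unfold Rdist in *.
  unfold g. replace (f (clamp A B x') - y - (f (clamp A B x) - y))
    with (- (f (clamp A B x) - f (clamp A B x'))) by ring.
  rewrite Rabs_Ropp. apply K; [now apply clamp_in|].
  eapply Rle_lt_trans; [now apply clamp_lip|]. now rewrite Rabs_minus_sym.
- assumption.
- unfold g. rewrite clamp_id by lra. lra.
- unfold g. rewrite clamp_id by lra. lra.
- exists z. split; [assumption|]. unfold g in Hz2. rewrite clamp_id in Hz2 by assumption. lra.
Qed.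

(** The values are enumerated by their codes, and some point between two distinct values escapes the
    enumeration, against the intermediate value theorem. *)
Lemma countable_image_constant A B f (code : R -> nat) : A <= B ->
  continuous_between A B f ->
  (forall u v, A <= u <= B -> A <= v <= B -> code u = code v -> f u = f v) ->
  f A = f B.
Proof.
assert (Main : forall f, A <= B -> continuous_between A B f ->
  (forall u v, A <= u <= B -> A <= v <= B -> code u = code v -> f u = f v) ->
  ~ f A < f B).
{ clear f. intros f HAB Hf Hcode Hlt.
  set (v := fun n => epsilon (inhabits 0) (fun y => exists u, A <= u <= B /\ code u = n /\ y = f u)).
  destruct (sequence_misses_point v (f A) (f B) Hlt) as [y [Hy Hv]].
  destruct (intermediate_value A B f y HAB Hf Hy) as [u [Hu E]].
  apply (Hv (code u)). rewrite <- E.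
  assert (S : exists u', A <= u' <= B /\ code u' = code u /\ v (code u) = f u').
  { apply (epsilon_spec (inhabits 0)
      (fun y => exists u', A <= u' <= B /\ code u' = code u /\ y = f u')).
    now exists (f u), u. }
  destruct S as (u' & Hu' & Ec & ->). now apply Hcode. }
intros HAB Hf Hcode.
destruct (Rtotal_order (f A) (f B)) as [L|[E|L]]; [exfalso|assumption|exfalso].
- exact (Main f HAB Hf Hcode L).
- apply (Main (fun x => - f x) HAB); [| |lra].
  + intros u Hu e He. destruct (Hf u Hu e He) as [del [Hd K]].
    exists del. split; [assumption|]. intros w Hw Hw2.
    replace (- f u - - f w) with (- (f u - f w)) by ring. rewrite Rabs_Ropp. now apply K.
  + intros u w Hu Hw E. f_equal. now apply Hcode.
Qed.

Fixpoint list_code (l : list nat) : nat :=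
  match l with nil => O | k :: l => S (to_nat (k, list_code l)) end.

Lemma list_code_inj l m : list_code l = list_code m -> l = m.
Proof.
revert m. induction l as [|k l IH]; intros [|j m] E; cbn [list_code] in E; try discriminate; [reflexivity|].
apply Nat.succ_inj, (f_equal of_nat) in E. rewrite !cancel_of_to in E.
injection E as -> E. f_equal. now apply IH.
Qed.

(** * Separability *)

Section Separable.
Variables (X : Type) (d : X -> X -> R).
Hypothesis (Hm : is_metric d).

Lemma compact_net K e : compact_set d K -> 0 < e ->
  exists l : list X, forall x, K x -> exists p, In p l /\ d p x < e.
Proof.
intros HK He.
destruct (HK (fun U => exists p, U = ball d p e)) as [L [HL1 HL2]].
- intros U [p ->] x Hx. unfold ball in *. exists (e - d p x). split; [lra|].
  intros y Hy. pose proof (metric_tri X d Hm x p y). lra.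
- intros x _. exists (ball d x e). split; [now exists x|]. unfold ball.
  now rewrite metric_refl.
- clear HK. revert K HL2. induction L as [|U L IH]; intros K HL2.
  + exists nil. intros x Hx. destruct (HL2 x Hx) as [U [[] _]].
  + destruct (HL1 U (or_introl eq_refl)) as [p ->].
    destruct (IH (fun U HU => HL1 U (or_intror HU)) (fun x => K x /\ ~ ball d p e x))
      as [l Hl].
    { intros x [Hx Hn]. destruct (HL2 x Hx) as [V [[<-|HV] HVx]]; [contradiction|now exists V]. }
    exists (p :: l). intros x Hx.
    destruct (classic (ball d p e x)) as [Hb|Hb].
    * exists p. split; [now left|exact Hb].
    * destruct (Hl x (conj Hx Hb)) as [q [Hq1 Hq2]]. exists q. split; [now right|assumption].
Qed.

Lemma compact_separable K (x0 : X) : compact_set d K ->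
  exists D : nat -> X, forall x e, K x -> 0 < e -> exists k, d (D k) x < e.
Proof.
intros HK.
destruct (choice (fun m l => forall x, K x -> exists p, In p l /\ d p x < / INR (S m)))
  as [L HL].
{ intros m. apply compact_net; [assumption|]. apply Rinv_0_lt_compat, lt_0_INR; lia. }
exists (fun k => let (m, j) := of_nat k in nth j (L m) x0).
intros x e Hx He. destruct (inv_nat_below e He) as [m Hmm].
destruct (HL m x Hx) as [p [Hp1 Hp2]].
destruct (In_nth _ _ x0 Hp1) as [j [_ Hj]].
exists (to_nat (m, j)). rewrite cancel_of_to, Hj. lra.
Qed.

(** One sequence serves all radii, so it depends on [x] alone and the construction can be iterated
    along lists. *)
Lemma locally_separable x : exists D : nat -> X, forall m,
  (exists K, compact_set d K /\ forall y, ball d x (/ INR (S m)) y -> K y) ->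
  forall y e, ball d x (/ INR (S m)) y -> 0 < e -> exists k, d (D k) y < e.
Proof.
destruct (choice (fun m (D : nat -> X) =>
  (exists K, compact_set d K /\ forall y, ball d x (/ INR (S m)) y -> K y) ->
  forall y e, ball d x (/ INR (S m)) y -> 0 < e -> exists k, d (D k) y < e)) as [D HD].
{ intros m. destruct (classic (exists K, compact_set d K /\
    forall y, ball d x (/ INR (S m)) y -> K y)) as [[K [HK1 HK2]]|C].
  - destruct (compact_separable K x HK1) as [D HD]. exists D. intros _ y e Hy He.
    apply HD; [now apply HK2|assumption].
  - exists (fun _ => x). intros C2. contradiction. }
exists (fun k => let (m, j) := of_nat k in D m j).
intros m HK y e Hy He. destruct (HD m HK y e Hy He) as [j Hj].
exists (to_nat (m, j)). now rewrite cancel_of_to.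
Qed.

(* The countable set is closed under passing to countable dense subsets of compact
   balls; its closure is open, hence everything since [X] is path connected. *)
Lemma separable (x0 : X) : locally_compact d -> geodesic_space d ->
  exists D : list nat -> X, forall x e, 0 < e -> exists l, d (D l) x < e.
Proof.
intros Hlc Hgs. destruct (choice _ locally_separable) as [N HN].
(* A list encodes finitely many moves from [x0], each to a member of the sequence attached to the
   current point. *)
set (D := fold_right (fun k x => N x k) x0). exists D.
set (C := fun y => forall e, 0 < e -> exists l, d (D l) y < e).
assert (Hopen : forall y, C y -> exists del, 0 < del /\ forall z, d y z < del -> C z).
{ intros y Hy. destruct (Hlc y) as [K [HK [r [Hr HrK]]]].
  destruct (inv_nat_below (r / 2)) as [m Hmm]; [lra|].
  set (rho := / INR (S m)) in *.
  assert (Hrho : 0 < rho) by (apply Rinv_0_lt_compat, lt_0_INR; lia).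
  destruct (Hy (rho / 2)) as [l Hl]; [lra|].
  exists (rho / 2). split; [lra|]. intros z Hz e He.
  destruct (HN (D l) m) with (y := z) (e := e) as [k Hk].
  - exists K. split; [assumption|]. intros p Hp. apply HrK. unfold ball in *.
    fold rho in Hp. pose proof (metric_tri X d Hm (D l) y p).
    rewrite (metric_sym X d Hm y (D l)) in *. lra.
  - unfold ball. fold rho. pose proof (metric_tri X d Hm y (D l) z). lra.
  - assumption.
  - now exists (k :: l). }
intros y. change (C y).
destruct (Hgs x0 y) as [c (E0 & E1 & Hiso)].
pose proof (metric_pos X d Hm x0 y) as HL.
destruct (completeness (fun t => 0 <= t <= d x0 y /\ C (c t))) as [s [Hs1 Hs2]].
- exists (d x0 y). intros t [Ht _]. lra.
- exists 0. split; [lra|]. rewrite E0. intros e He. exists nil. simpl.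
  now rewrite metric_refl.
- assert (Hs : 0 <= s <= d x0 y).
  { split.
    - apply Hs1. split; [lra|]. rewrite E0. intros e He. exists nil. simpl.
      now rewrite metric_refl.
    - apply Hs2. intros t [Ht _]. lra. }
  assert (HCs : C (c s)).
  { intros e He.
    assert (exists t, 0 <= t <= d x0 y /\ C (c t) /\ s - e / 2 < t <= s) as (t & Ht & HCt & Hts).
    { apply NNPP. intros NC. assert (s <= s - e / 2); [|lra]. apply Hs2. intros t [Ht HCt].
      apply Rnot_lt_le. intros L. apply NC. exists t. split; [assumption|].
      split; [assumption|]. split; [assumption|]. now apply Hs1. }
    destruct (HCt (e / 2)) as [l Hl]; [lra|]. exists l.
    pose proof (metric_tri X d Hm (c t) (D l) (c s)).
    rewrite (Hiso t s) in H by assumption. rewrite <- Rabs_Ropp, Rabs_right in H by lra. lra. }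
  destruct (Req_dec s (d x0 y)) as [E|Ne]; [now rewrite E, E1 in HCs|].
  destruct (Hopen _ HCs) as [del [Hdel K]].
  set (t := Rmin (d x0 y) (s + del / 2)).
  assert (Ht : s < t <= d x0 y /\ t <= s + del / 2).
  { unfold t. split; [split; [apply Rmin_glb_lt; lra|apply Rmin_l]|apply Rmin_r]. }
  assert (t <= s); [|lra]. apply Hs1. split; [lra|]. apply K.
  rewrite Hiso by lra. rewrite <- Rabs_Ropp, Rabs_right by lra. lra.
Qed.

End Separable.

(** * Lines without flat points are visible from afar *)

Section Visibility.
Variables (X : Type) (d : X -> X -> R).
Hypothesis (HN : nice d).

Lemma point_at_distance x y t : 0 <= t <= d x y ->
  exists m, d x m = t /\ d m y = d x y - t.
Proof.
destruct HN as (Hm & Hc & _ & _). intros Ht.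
destruct (Req_dec (d x y) 0) as [Z|Z].
- exists x. rewrite metric_refl by assumption. lra.
- assert (Hl : 0 <= t / d x y <= 1).
  { split; [apply Rmult_le_pos; [lra|apply Rlt_le, Rinv_0_lt_compat; lra]|].
    apply Rmult_le_reg_r with (d x y); [lra|]. unfold Rdiv.
    rewrite Rmult_assoc, Rinv_l; lra. }
  destruct (btw_exists X d Hm Hc x y _ Hl) as [m [B1 B2]].
  exists m. split; [rewrite B1|rewrite B2]; field; lra.
Qed.

Lemma ratio_btw x y m : d x y = d x m + d m y -> 0 < d x y -> btw X d x y (d x m / d x y) m.
Proof.
intros H Hp. split; [field; lra|]. unfold Rdiv.
replace ((1 - d x m * / d x y) * d x y) with (d x y - d x m) by (field; lra). lra.
Qed.

Lemma ratio_range x y m : d x y = d x m + d m y -> 0 < d x y -> 0 <= d x m / d x y <= 1.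
Proof.
destruct HN as (Hm & _). intros H Hp.
pose proof (metric_pos X d Hm x m). pose proof (metric_pos X d Hm m y). split.
- apply Rmult_le_pos; [assumption|]. apply Rlt_le, Rinv_0_lt_compat; lra.
- apply Rmult_le_reg_r with (d x y); [lra|]. unfold Rdiv.
  rewrite Rmult_assoc, Rinv_l; lra.
Qed.

(** If both Busemann values at a point of the sphere were nonpositive, the point would be flat,
    hence [b 0]. So one is positive, also nearby by the Lipschitz property, and compactness makes
    the bound uniform. *)
Lemma flat_free_gap b r : complete_geodesic d b -> flat_free d b -> 0 < r ->
  (exists K, compact_set d K /\ forall y, d (b 0) y = r -> K y) ->
  exists m, 0 < m /\ forall g, d (b 0) g = r -> m <= bus X d b g \/ m <= bus X d (reversed b) g.
Proof.
destruct HN as (Hm & Hc & _ & _). intros Hb Hff Hr [K [HK HKr]].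
pose proof (geodesic_pgeod X d b Hb) as Hp. pose proof (pgeod_rev X d Hm b Hp) as Hp'.
set (P := fun (U : X -> Prop) m => forall g, U g -> d (b 0) g = r ->
  m <= bus X d b g \/ m <= bus X d (reversed b) g).
assert (Hball : forall p e, Defs.open_set d (ball d p e)).
{ intros p e x Hx. unfold ball in *. exists (e - d p x). split; [lra|].
  intros y Hy. pose proof (metric_tri X d Hm x p y). lra. }
destruct (HK (fun U => Defs.open_set d U /\ exists m, 0 < m /\ P U m)) as [L [HL1 HL2]].
- tauto.
- intros p _. destruct (Req_dec (d (b 0) p) r) as [E|Ne].
  + assert (exists m, 0 < m /\ (m <= bus X d b p \/ m <= bus X d (reversed b) p))
      as [m [Hm0 Hmp]].
    { destruct (Rlt_le_dec 0 (bus X d b p)) as [A|A]; [eexists; split; [exact A|left; lra]|].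
      destruct (Rlt_le_dec 0 (bus X d (reversed b) p)) as [B|B];
        [eexists; split; [exact B|right; lra]|].
      exfalso. pose proof (bus_sum_nonneg X d Hm b p Hp) as S.
      destruct (Hff p) as [s ->]; [unfold flat; lra|].
      pose proof (psi_geodesic X d Hm b s Hb) as E2. unfold psi in E2.
      assert (s = 0) as -> by lra. rewrite metric_refl in E by assumption. lra. }
    exists (ball d p (m / 2)). split; [split; [apply Hball|]|].
    * exists (m / 2). split; [lra|]. intros g Hg _. unfold ball in Hg.
      pose proof (bus_le X d Hm b p g Hp). pose proof (bus_le X d Hm (reversed b) p g Hp'). lra.
    * unfold ball. rewrite metric_refl by assumption. lra.
  + assert (Hpos : 0 < Rabs (d (b 0) p - r)) by (apply Rabs_pos_lt; lra).
    exists (ball d p (Rabs (d (b 0) p - r))). split; [split; [apply Hball|]|].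
    * exists 1. split; [lra|]. intros g Hg Eg. exfalso. unfold ball in Hg.
      pose proof (metric_lip X d Hm p g (b 0)) as L.
      rewrite (metric_sym X d Hm p (b 0)), (metric_sym X d Hm g (b 0)), Eg in L. lra.
    * unfold ball. now rewrite metric_refl by assumption.
- assert (exists m, 0 < m /\ forall U, In U L -> P U m) as [m [Hm0 HmL]].
  { clear HL2. induction L as [|U L IH].
    - exists 1. split; [lra|]. intros U [].
    - destruct IH as [m1 [A1 A2]]. { intros V HV. apply HL1. now right. }
      destruct (HL1 U (or_introl eq_refl)) as [_ [m2 [B1 B2]]].
      exists (Rmin m1 m2). split; [now apply Rmin_pos|].
      pose proof (Rmin_l m1 m2). pose proof (Rmin_r m1 m2).
      intros V [<-|HV] g Hg Eg; [destruct (B2 g Hg Eg)|destruct (A2 V HV g Hg Eg)]; lra. }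
  exists m. split; [assumption|]. intros g Eg.
  destruct (HL2 g (HKr g Eg)) as [U [HU HUg]]. exact (HmL U HU g HUg Eg).
Qed.

(** As [g] is no farther from [x] than [q] is, comparison along the segment from [q] to [x] gives
    [d g z ^ 2 <= d q z ^ 2 + r ^ 2]. Hence [d g z] barely exceeds [d q z], and [z] is close to
    [b N]. *)
Lemma far_point_bound b q g x z N e r : complete_geodesic d b ->
  d q g = r -> d x g <= d q x -> d q x = d q z + d z x ->
  d z (b (INR N)) <= e -> e <= 1 -> 2 <= INR N -> d q (b (INR N)) = INR N ->
  bus X d b g <= 2 * e + r ^ 2 / (2 * (INR N - 1)).
Proof.
destruct HN as (Hm & Hc & _ & _). intros Hb Hr Hg Hz He He1 HN2 HqN.
pose proof (geodesic_pgeod X d b Hb) as Hp.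
pose proof (metric_tri X d Hm z q (b (INR N))) as T1.
pose proof (metric_tri X d Hm (b (INR N)) q z) as T2.
rewrite (metric_sym X d Hm (b (INR N)) z) in T2.
pose proof (metric_pos X d Hm z x).
set (t := d q z) in *.
assert (Ht : INR N - 1 <= t) by lra.
assert (Hgz : d g z ^ 2 <= t ^ 2 + r ^ 2).
{ pose proof (btw_comparison X d Hm Hc q x _ z g (ratio_range q x z Hz ltac:(lra))
    (ratio_btw q x z Hz ltac:(lra))) as K. fold t in K.
  pose proof (ratio_range q x z Hz ltac:(lra)) as R. fold t in R.
  rewrite (metric_sym X d Hm g q), (metric_sym X d Hm g x), Hr in K.
  set (l := t / d q x) in *.
  assert (Et : t = l * d q x) by (unfold l; field; lra).
  assert (d x g ^ 2 <= d q x ^ 2) by (apply pow_incr; split; [now apply metric_pos|assumption]).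
  pose proof (pow2_ge_0 r). rewrite Et. nra. }
assert (Hq : 0 <= r ^ 2 / (2 * (INR N - 1))).
{ apply Rmult_le_pos; [apply pow2_ge_0|]. apply Rlt_le, Rinv_0_lt_compat; lra. }
assert (Hgz2 : d g z <= t + r ^ 2 / (2 * (INR N - 1))).
{ set (k := r ^ 2 / (2 * (INR N - 1))) in *.
  assert (Ek : r ^ 2 = k * (2 * (INR N - 1))) by (unfold k; field; lra).
  apply Rsqr_le_cancel; [lra|]. nra. }
pose proof (proj1 (bus_is_inf X d Hm b g Hp) N) as L. cbv beta in L.
pose proof (metric_tri X d Hm z g (b (INR N))). lra.
Qed.

(* A quantitative form of Ballmann's lemma on rank one geodesics. If the
   geodesic from [x] to [y] stayed away from [b 0], both Busemann functions of [b] would be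
   almost nonpositive at a point at distance [r] from [b 0]. *)
Lemma gromov_product_small b r0 N0 : complete_geodesic d b -> flat_free d b -> 0 < r0 ->
  exists N K : nat, (N0 <= N)%nat /\ forall x y z z',
    d (b 0) x = d (b 0) z + d z x -> d z (b (- INR N)) <= / INR (S K) ->
    d (b 0) y = d (b 0) z' + d z' y -> d z' (b (INR N)) <= / INR (S K) ->
    d (b 0) x + d (b 0) y - 2 * r0 <= d x y.
Proof.
pose proof HN as (Hm & Hc & Hl & _). intros Hb Hff Hr0.
set (q := b 0).
destruct (Hl q) as [K [HK [rho [Hrho HrK]]]].
set (r := Rmin r0 rho / 2).
assert (Hr : 0 < r /\ r < rho /\ r < r0).
{ pose proof (Rmin_l r0 rho). pose proof (Rmin_r r0 rho).
  assert (0 < Rmin r0 rho) by now apply Rmin_pos. unfold r. lra. }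
destruct (flat_free_gap b r Hb Hff (proj1 Hr)) as [m [Hm0 Hgap]].
{ exists K. split; [assumption|]. intros y Hy. apply HrK. unfold ball, q. lra. }
destruct (nat_above (2 + r ^ 2 / m)) as [N1 HN1].
destruct (inv_nat_below (Rmin (m / 4) 1)) as [k Hk]; [apply Rmin_pos; lra|].
pose proof (Rmin_l (m / 4) 1). pose proof (Rmin_r (m / 4) 1).
assert (Hrm : 0 <= r ^ 2 / m).
{ apply Rmult_le_pos; [apply pow2_ge_0|]. apply Rlt_le, Rinv_0_lt_compat; lra. }
exists (N0 + N1)%nat, k. split; [lia|].
set (N := (N0 + N1)%nat).
assert (HNN : 2 + r ^ 2 / m < INR N).
{ unfold N. rewrite plus_INR. pose proof (pos_INR N0). lra. }
set (e := / INR (S k)) in *.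
assert (Hbd : 2 * e + r ^ 2 / (2 * (INR N - 1)) < m).
{ assert (r ^ 2 / (2 * (INR N - 1)) <= m / 2).
  { apply Rmult_le_reg_r with (2 * (INR N - 1)); [lra|].
    unfold Rdiv at 1. rewrite Rmult_assoc, Rinv_l by lra.
    assert (r ^ 2 = r ^ 2 / m * m) by (field; lra). nra. }
  lra. }
intros x y z z' Hx Hzx Hy Hzy.
apply Rnot_lt_le. intros C.
(* Twice the Gromov product at [q]. The point [f] below is closer than [q] to both [x] and [y], and
   at distance at least [G / 2 > r] from [q]; convexity carries the comparison over to [g]. *)
set (G := d q x + d q y - d x y).
assert (HG : 2 * r0 < G) by (unfold G; lra).
pose proof (metric_tri X d Hm x q y) as T1. pose proof (metric_tri X d Hm y q x) as T2.
pose proof (metric_tri X d Hm q x y) as T3.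
rewrite (metric_sym X d Hm y x) in T2. rewrite (metric_sym X d Hm x q) in T3.
destruct (point_at_distance x y (d q x - G / 2)) as [f [Hf1 Hf2]]; [unfold G; lra|].
pose proof (metric_tri X d Hm f q x) as T4. rewrite (metric_sym X d Hm f x) in T4.
destruct (point_at_distance q f r) as [g [Hg1 Hg2]]; [lra|].
assert (Hqf : 0 < d q f) by lra.
assert (Hgg : d q f = d q g + d g f) by lra.
pose proof (ratio_btw q f g Hgg Hqf) as B. pose proof (ratio_range q f g Hgg Hqf) as R.
pose proof (btw_convex_point X d Hm Hc q f _ g x R B) as K1.
pose proof (btw_convex_point X d Hm Hc q f _ g y R B) as K2.
rewrite (metric_sym X d Hm f x) in K1.
assert (E2 : d f y <= d q y) by (rewrite Hf2; unfold G; lra).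
assert (E1 : d x f <= d q x) by lra.
set (l := d q g / d q f) in *.
assert (A1 : d x g <= d q x) by (rewrite (metric_sym X d Hm x g); nra).
assert (A2 : d y g <= d q y) by (rewrite (metric_sym X d Hm y g); nra).
pose proof (far_point_bound b q g y z' N e r Hb Hg1 A2 Hy Hzy ltac:(lra) ltac:(lra)) as F1.
pose proof (far_point_bound (reversed b) q g x z N e r
  (complete_geodesic_rev X d b Hb) Hg1 A1 Hx Hzx ltac:(lra) ltac:(lra)) as F2.
unfold reversed at 1 in F2. unfold q in F1, F2. rewrite !Hb in F1, F2.
rewrite Rminus_0_l, Rabs_Ropp, Rabs_right in F1 by (pose proof (pos_INR N); lra).
rewrite Rminus_0_l, Ropp_involutive, Rabs_right in F2 by (pose proof (pos_INR N); lra).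
specialize (F1 eq_refl). specialize (F2 eq_refl).
destruct (Hgap g Hg1); lra.
Qed.

End Visibility.

Lemma unit_periodic_constant (h : R -> R) (C : R) :
  (forall s, h (s + 1) = h s) -> (forall s, -1 <= s <= 0 -> h s = C) -> forall s, h s = C.
Proof.
intros Hp HC.
assert (Hn : forall n s, h (s + INR n) = h s).
{ induction n as [|n IH]; intros s.
  - simpl. now rewrite Rplus_0_r.
  - rewrite S_INR, <- Rplus_assoc, Hp. apply IH. }
intros s. destruct (archimed s) as [A B].
destruct (Z_le_gt_dec 0 (up s)) as [L|L].
- rewrite <- (HC (s - IZR (up s))) by lra.
  rewrite <- (Hn (Z.to_nat (up s)) (s - IZR (up s))), INR_IZR_INZ, Z2Nat.id by assumption.
  f_equal. ring.
- rewrite <- (HC (s - IZR (up s))) by lra.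
  rewrite <- (Hn (Z.to_nat (- up s)) s), INR_IZR_INZ, Z2Nat.id, opp_IZR by lia.
  f_equal.
Qed.

(** * Segments issuing from a common point *)

Section Segments.
Variables (X : Type) (d : X -> X -> R).
Hypothesis (HN : nice d).

(** Radial projection onto a sphere around [q] does not increase distances between points outside.
    The terms with [l - k] add up to at most 0 by the arithmetic-geometric mean inequality. *)
Lemma segment_point_contract q y y' m n : d q m = d q n ->
  d q y = d q m + d m y -> d q y' = d q n + d n y' -> d m n <= d y y'.
Proof.
pose proof HN as (Hm & Hc & _ & _). intros E Hy Hy'.
pose proof (metric_pos X d Hm q m). pose proof (metric_pos X d Hm m y).
pose proof (metric_pos X d Hm n y'). pose proof (metric_pos X d Hm y y').
destruct (Req_dec (d q m) 0) as [Z|Z].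
{ assert (q = m) as <- by now apply (metric_eq X d Hm).
  assert (q = n) as <- by (apply (metric_eq X d Hm); lra).
  rewrite metric_refl by assumption. lra. }
assert (P1 : 0 < d q y) by lra. assert (P2 : 0 < d q y') by lra.
pose proof (ratio_range X d HN q y m Hy P1) as R1.
pose proof (ratio_range X d HN q y' n Hy' P2) as R2.
pose proof (btw_two_sides X d Hm Hc _ _ _ _ _ _ _ R1 R2
  (ratio_btw X d q y m Hy P1) (ratio_btw X d q y' n Hy' P2)) as K.
assert (El : d q m / d q y * d q y = d q m) by (field; lra).
assert (Ek : d q n / d q y' * d q y' = d q m) by (rewrite E; field; lra).
set (l := d q m / d q y) in *. set (k := d q n / d q y') in *.
set (A := d q y) in *. set (B := d q y') in *. set (t := d q m) in *.
set (c := d y y') in *.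
assert (S : l * (l - k) * A ^ 2 + k * (k - l) * B ^ 2 <= 0).
{ replace (l * (l - k) * A ^ 2 + k * (k - l) * B ^ 2)
    with ((l * A) ^ 2 + (k * B) ^ 2 - (l * A) * (k * A) - (k * B) * (l * B)) by ring.
  rewrite El, Ek.
  assert (0 <= k * A) by (apply Rmult_le_pos; lra).
  assert (0 <= l * B) by (apply Rmult_le_pos; lra).
  assert (E4 : (k * A) * (l * B) = t ^ 2).
  { replace ((k * A) * (l * B)) with ((l * A) * (k * B)) by ring. rewrite El, Ek. ring. }
  assert (2 * t <= k * A + l * B).
  { apply Rsqr_le_cancel; [lra|]. pose proof (pow2_ge_0 (k * A - l * B)). nra. }
  nra. }
assert (l * k * c ^ 2 <= c ^ 2).
{ pose proof (pow2_ge_0 c). assert (0 <= l * k <= 1) by nra. nra. }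
apply Rsqr_le_cancel; lra.
Qed.

Lemma segment_point_unique q y m n : d q m = d q n ->
  d q y = d q m + d m y -> d q y = d q n + d n y -> m = n.
Proof.
pose proof HN as (Hm & _). intros E H1 H2. apply (metric_eq X d Hm).
pose proof (segment_point_contract q y y m n E H1 H2) as K.
rewrite (metric_refl X d Hm y) in K. pose proof (metric_pos X d Hm m n). lra.
Qed.

(** The conclusion of [gromov_product_small]: segments from [b 0] passing close to [b (-N)] and
    [b N] end at points with Gromov product at most [r]. *)
Definition sees (b : R -> X) (r : R) (N K : nat) : Prop := forall x y z z',
  d (b 0) x = d (b 0) z + d z x -> d z (b (- INR N)) <= / INR (S K) ->
  d (b 0) y = d (b 0) z' + d z' y -> d z' (b (INR N)) <= / INR (S K) ->
  d (b 0) x + d (b 0) y - 2 * r <= d x y.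

(** [sees] is applied to distant points of both lines; late indices suffice since [endpair]
    decreases. The upper bound 0 comes from the common point [b 0]. *)
Lemma sees_endpair b r N K g1 g2 t1 t2 : sees b r N K ->
  complete_geodesic d g1 -> complete_geodesic d g2 -> g1 0 = b 0 -> g2 0 = b 0 ->
  0 <= t1 -> 0 <= t2 ->
  d (g1 (- t1)) (b (- INR N)) <= / INR (S K) -> d (g2 t2) (b (INR N)) <= / INR (S K) ->
  (forall k, - 2 * r <= endpair X d g1 g2 0 0 k) /\
  - 2 * r <= infn (endpair X d g1 g2 0 0) <= 0.
Proof.
pose proof HN as (Hm & _). intros Hs G1 G2 E1 E2 Ht1 Ht2 N1 N2.
assert (HB : forall k, - 2 * r <= endpair X d g1 g2 0 0 k).
{ intros k. destruct (nat_above (t1 + t2)) as [j Hj].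
  pose proof (decr_le _ k (k + j) (endpair_decr X d Hm g1 g2 0 0
    (geodesic_pgeod X d g1 G1) (geodesic_pgeod X d g2 G2)) ltac:(lia)) as L.
  eapply Rle_trans; [|exact L]. unfold endpair.
  rewrite Rminus_0_l, Rplus_0_l. rewrite plus_INR. pose proof (pos_INR k).
  set (n := INR k + INR j) in *. assert (Hn : t1 + t2 < n) by (unfold n; lra).
  assert (D1 : forall u v, v <= u -> d (g1 (- v)) (g1 (- u)) = u - v).
  { intros u v Huv. rewrite G1, Rabs_right; lra. }
  assert (D2 : forall u v, v <= u -> d (g2 v) (g2 u) = u - v).
  { intros u v Huv. rewrite G2, <- Rabs_Ropp, Rabs_right; lra. }
  pose proof (Hs (g1 (- n)) (g2 n) (g1 (- t1)) (g2 t2)) as Q.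
  assert (P1 : forall u, 0 <= u -> d (b 0) (g1 (- u)) = u).
  { intros u Hu. rewrite <- E1, G1, Rabs_right; lra. }
  assert (P2 : forall u, 0 <= u -> d (b 0) (g2 u) = u).
  { intros u Hu. rewrite <- E2, G2, <- Rabs_Ropp, Rabs_right; lra. }
  rewrite !P1, !P2, D1, D2 in Q by lra.
  specialize (Q ltac:(lra) N1 ltac:(lra) N2). lra. }
split; [assumption|].
destruct (infn_spec _ _ HB) as [I1 I2]. split.
- apply Rnot_lt_le. intros C. destruct (I2 (- 2 * r - infn (endpair X d g1 g2 0 0))) as [n Hn];
  [lra|]. specialize (HB n). lra.
- specialize (I1 0%nat). unfold endpair in I1 at 2. simpl in I1.
  rewrite Rminus_0_r, Rplus_0_r, E1, E2, metric_refl in I1 by assumption. lra.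
Qed.

End Segments.

(** * Lines linked to [a] *)

Section Rigidity.
Variables (X : Type) (d d' : X -> X -> R).
Hypotheses (HN : nice d) (HN' : nice d')
  (H1 : forall x y, d x y <= 1 <-> d' x y <= 1).
Variables (a : R -> X) (k0 : R) (D : list nat -> X).
Hypotheses (Ha : complete_geodesic d a) (Hk0 : 0 < k0)
  (Hper : forall tau, 0 < tau < k0 -> ~ period (psi X d' a) tau)
  (HD : forall x e, 0 < e -> exists l, d (D l) x < e).

(** Linkage is recorded by its effect on the parameter change, which preserves the set of periods,
    rather than by a chain of lines. *)
Definition linked (b : R -> X) : Prop :=
  complete_geodesic d b /\ exists h C, forall s, psi X d' b s = psi X d' a (s + h) + C.

Lemma linked_no_translation b tau C : linked b -> 0 <= tau < k0 ->
  (forall s, psi X d' b (s + tau) = psi X d' b s + C) -> tau = 0.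
Proof.
intros [Hb (h & C' & E)] Ht HC.
destruct (Req_dec tau 0) as [|Ne]; [assumption|exfalso].
apply (Hper tau); [lra|].
apply (period_shift _ _ h C' tau E).
apply translation_period with (C := C); [|lra|assumption].
now apply (psi_unit_increasing X d d').
Qed.

Lemma linked_flat_free b : linked b -> flat_free d b.
Proof.
intros Hb. apply NNPP. intros Hff. pose proof Hb as [Hg _].
destruct (strip_period X d d' HN HN' H1 b Hg Hff) as (k & Hk & K).
set (tau := Rmin (k0 / 2) (k / 2)).
assert (0 < tau /\ tau <= k0 / 2 /\ tau <= k / 2).
{ unfold tau. split; [apply Rmin_pos; lra|]. split; [apply Rmin_l|apply Rmin_r]. }
assert (tau = 0); [|lra].
apply (linked_no_translation b tau tau Hb); [lra|]. apply K. lra.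
Qed.

Lemma linked_dist b s t : linked b -> s <= t ->
  d' (b s) (b t) = psi X d' b t - psi X d' b s.
Proof.
intros Hb Hst. pose proof Hb as [Hg _].
rewrite (flat_free_dist X d d' HN HN' H1) by (try assumption; now apply linked_flat_free).
assert (psi X d' b s <= psi X d' b t).
{ destruct Hst as [L| ->]; [|lra]. apply Rlt_le. now apply (psi_incr X d d'). }
rewrite <- Rabs_Ropp, Rabs_right; lra.
Qed.

Lemma linked_backward b g M : linked b -> complete_geodesic d g ->
  (forall k, M <= endpair X d g b 0 0 k) -> linked g.
Proof.
intros [Hb (h & C & E)] Hg HM. split; [assumption|].
destruct (end_transfer X d d' HN HN' H1 g b M Hg Hb HM) as [C' K].
exists (- infn (endpair X d g b 0 0) + h), (C - C'). intros s. specialize (K s). rewrite E in K.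
replace (s + (- infn (endpair X d g b 0 0) + h)) with (s - infn (endpair X d g b 0 0) + h) by ring.
lra.
Qed.

Lemma linked_forward b g M : linked b -> complete_geodesic d g ->
  (forall k, M <= endpair X d b g 0 0 k) -> linked g.
Proof.
intros [Hb (h & C & E)] Hg HM. split; [assumption|].
destruct (end_transfer X d d' HN HN' H1 b g M Hb Hg HM) as [C' K].
set (H0 := infn _) in *.
exists (H0 + h), (C + C'). intros s. specialize (K (s + H0)).
replace (s + H0 - H0) with s in K by ring. rewrite K, E.
replace (s + H0 + h) with (s + (H0 + h)) by ring. ring.
Qed.

Lemma linked_shift b th : linked b -> linked (fun s => b (s + th)).
Proof.
destruct HN' as (Hm' & Hc' & _). intros [Hb (h & C & E)].
assert (Hg : complete_geodesic d (fun s => b (s + th))).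
{ intros s t. rewrite Hb. f_equal. ring. }
split; [assumption|].
pose proof (geodesic_pgeod_transfer X d d' HN HN' H1 b Hb) as Hp.
exists (th + h), (C - psi X d' b th). intros s.
assert (F : bus X d' (fun s => b (s + th)) (b (s + th)) = bus X d' b (b (s + th)) + psi X d' b th).
{ apply is_inf_unique with (f := fun n => d' (b (s + th)) (b (INR n + th)) - INR n).
  - apply (bus_is_inf X d' Hm' (fun s => b (s + th))).
    now apply (geodesic_pgeod_transfer X d d').
  - pose proof (bus_shift X d' Hm' Hc' b (b (s + th)) th Hp) as [I1 I2]. split.
    + intros n. rewrite (Rplus_comm (INR n)). apply I1.
    + intros e He. destruct (I2 e He) as [n Hn]. exists n. now rewrite (Rplus_comm (INR n)). }
specialize (E (s + th)). rewrite Rplus_assoc in E.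
unfold psi in *. rewrite F. lra.
Qed.

(* Near [b (-T)] every geodesic to [b 0] continues to a line containing the
   ray [b [0, oo)]. Let [G x] extend the segment from [x] to [b 0], and let [- H x] be the
   amount by which this line and the ray fail to form a line. The parameter change of [G x] is
   that of [b] translated by [H x]. It varies continuously with [x], since it is read off
   from [d']-distances on the unit segment next to [b 0]; and it takes countably
   many values, since two nearby lines [G x], [G y] have the same one. Hence it is constant,
   and [H x = 0]. *)
Lemma linked_shadow b : linked b -> exists T e, 1 <= T /\ 0 < e <= 1 /\
  forall x, d (b (- T)) x < e ->
    exists c, linked c /\ (forall s, 0 <= s -> c s = b s) /\ c (- d x (b 0)) = x.
Proof.
pose proof HN as (Hm & Hc & Hl & Hgc). pose proof HN' as (Hm' & Hc' & Hl' & Hgc').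
intros Hb. pose proof Hb as [Hbg _]. set (q := b 0).
(* Two end distances in [[- 2 r, 0]] add up to a shift of at most [k0 / 2], short enough to be
   excluded as a period. *)
set (r := k0 / 8).
assert (Hsee : forall c, linked c -> exists N K, (2 <= N)%nat /\ sees X d c r N K).
{ intros c Hcl. destruct (gromov_product_small X d HN c r 2 (proj1 Hcl)
    (linked_flat_free c Hcl)) as (N & K & HN2 & HK); [unfold r; lra|].
  exists N, K. split; assumption. }
destruct (Hsee b Hb) as (N & K & HN2 & HS).
set (T := INR N). set (e := / INR (S K)).
assert (HT : 2 <= T) by (unfold T; apply (le_INR 2) in HN2; simpl in HN2; lra).
assert (He : 0 < e <= 1).
{ unfold e. rewrite S_INR. pose proof (pos_INR K).
  split; [apply Rinv_0_lt_compat; lra|]. rewrite <- Rinv_1 at 2. apply Rinv_le_contravar; lra. }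
exists T, e. split; [lra|]. split; [assumption|].
set (O := fun x => d (b (- T)) x < e).
assert (HqT : d q (b (- T)) = T) by (unfold q; rewrite Hbg, Rabs_right; lra).
assert (HO1 : forall x, O x -> 1 <= d q x).
{ intros x Hx. unfold O in Hx. pose proof (metric_tri X d Hm x q (b (- T))) as Tr.
  rewrite (metric_sym X d Hm x) in Tr. lra. }
assert (SG : forall x, exists g, O x ->
  complete_geodesic d g /\ g 0 = q /\ g (- d q x) = x).
{ intros x. destruct (classic (O x)) as [Hx|Hx]; [|exists b; tauto].
  pose proof (HO1 x Hx).
  destruct (line_through X d Hm Hgc q x) as [g (G1 & G2 & G3)].
  { intros E. rewrite <- E, metric_refl in H by assumption. lra. }
  exists (reversed g). intros _. split; [now apply complete_geodesic_rev|].
  unfold reversed. now rewrite Ropp_0, Ropp_involutive. }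
destruct (choice _ SG) as [G HG]. clear SG.
assert (HGb : forall x, O x -> (forall k, - 2 * r <= endpair X d (G x) b 0 0 k) /\
  - 2 * r <= infn (endpair X d (G x) b 0 0) <= 0).
{ intros x Hx. destruct (HG x Hx) as (G1 & G2 & G3).
  apply (sees_endpair X d HN b r N K (G x) b (d q x) T); try assumption; try reflexivity.
  - now apply metric_pos.
  - lra.
  - rewrite G3, (metric_sym X d Hm x). apply Rlt_le, Hx.
  - unfold T. rewrite metric_refl by assumption. fold e. lra. }
assert (HGl : forall x, O x -> linked (G x)).
{ intros x Hx. apply linked_backward with (b := b) (M := - 2 * r); try apply Hb.
  - now apply HG.
  - now apply HGb. }
(* The code of [x] records scales at which [G x] sees, and dense points near [G x (-N)] and [G x N].
   Equal codes thus place the two lines within [/ INR (S K)] of each other there. *)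
assert (SC : forall x, exists m : list nat, O x -> exists N K i j,
  m = N :: K :: list_code i :: list_code j :: nil /\ sees X d (G x) r N K /\
  d (D i) (G x (- INR N)) < / INR (S K) / 2 /\ d (D j) (G x (INR N)) < / INR (S K) / 2).
{ intros x. destruct (classic (O x)) as [Hx|Hx]; [|exists nil; tauto].
  destruct (Hsee (G x) (HGl x Hx)) as (Nx & Kx & _ & HSx).
  assert (P : 0 < / INR (S Kx) / 2).
  { apply Rdiv_lt_0_compat; [|lra]. apply Rinv_0_lt_compat, lt_0_INR; lia. }
  destruct (HD (G x (- INR Nx)) _ P) as [i Hi]. destruct (HD (G x (INR Nx)) _ P) as [j Hj].
  exists (Nx :: Kx :: list_code i :: list_code j :: nil). intros _. now exists Nx, Kx, i, j. }
destruct (choice _ SC) as [code Hcode]. clear SC.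
assert (Same : forall x y, O x -> O y -> code x = code y ->
  exists C, forall s, psi X d' (G x) s = psi X d' (G y) s + C).
{ intros x y Hx Hy E.
  destruct (Hcode x Hx) as (Nx & Kx & i & j & E1 & S1 & A1 & A2).
  destruct (Hcode y Hy) as (Ny & Ky & i' & j' & E2 & S2 & B1 & B2).
  rewrite E1, E2 in E. injection E as -> -> Ei Ej.
  apply list_code_inj in Ei, Ej. subst i' j'. clear E1 E2 S2.
  destruct (HG x Hx) as (X1 & X2 & _). destruct (HG y Hy) as (Y1 & Y2 & _).
  assert (Q1 : d (G y (- INR Ny)) (G x (- INR Ny)) <= / INR (S Ky)).
  { pose proof (metric_tri X d Hm (D i) (G y (- INR Ny)) (G x (- INR Ny))) as Tr.
    rewrite (metric_sym X d Hm (G y (- INR Ny)) (D i)) in Tr. lra. }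
  assert (Q2 : d (G y (INR Ny)) (G x (INR Ny)) <= / INR (S Ky)).
  { pose proof (metric_tri X d Hm (D j) (G y (INR Ny)) (G x (INR Ny))) as Tr.
    rewrite (metric_sym X d Hm (G y (INR Ny)) (D j)) in Tr. lra. }
  assert (Q0 : forall p : X, d p p <= / INR (S Ky)).
  { intros p. rewrite metric_refl by assumption.
    apply Rlt_le, Rinv_0_lt_compat, lt_0_INR; lia. }
  pose proof (pos_INR Ny) as PN.
  assert (XY : G y 0 = G x 0) by now rewrite X2, Y2.
  destruct (sees_endpair X d HN (G x) r Ny Ky (G y) (G x) _ _ S1 Y1 X1 XY eq_refl
    PN PN Q1 (Q0 _)) as [M1 R1].
  destruct (sees_endpair X d HN (G x) r Ny Ky (G x) (G y) _ _ S1 X1 Y1 eq_refl XY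
    PN PN (Q0 _) Q2) as [M2 R2].
  destruct (end_transfer X d d' HN HN' H1 _ _ _ Y1 X1 M1) as [C1 K1].
  destruct (end_transfer X d d' HN HN' H1 _ _ _ X1 Y1 M2) as [C2 K2].
  set (h1 := infn (endpair X d (G y) (G x) 0 0)) in *.
  set (h2 := infn (endpair X d (G x) (G y) 0 0)) in *.
  (* Passing from [G x] to [G y] and back translates [psi] of [G x], so the total shift vanishes. *)
  assert (Z : - h1 - h2 = 0).
  { apply (linked_no_translation (G x) _ (C1 + C2) (HGl x Hx)); [unfold r in *; lra|].
    intros s. replace (s + (- h1 - h2)) with (s - h2 - h1) by ring.
    rewrite K1, K2. ring. }
  exists C1. intros s. rewrite <- K1. f_equal. lra. }
intros x Hx.
assert (Econst : forall t, 0 <= t <= 1 -> d' q (G x (- t)) = d' q (b (- t))).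
{ intros t Ht.
  destruct (proj1 Hgc (b (- T)) x) as [c (E0 & E1 & Hiso)].
  set (L := d (b (- T)) x) in *. pose proof (metric_pos X d Hm (b (- T)) x) as HL. fold L in HL.
  assert (HcO : forall u, 0 <= u <= L -> O (c u)).
  { intros u Hu. unfold O. rewrite <- E0, Hiso by lra.
    rewrite <- Rabs_Ropp, Rabs_right by lra. unfold O in Hx. fold L in Hx. lra. }
  assert (Hseg : forall y, O y -> d q (G y (- t)) = t /\ d q y = t + d (G y (- t)) y).
  { intros y Hy. destruct (HG y Hy) as (G1 & G2 & G3). pose proof (HO1 y Hy).
    rewrite <- G2 at 1. rewrite G1, Rabs_right by lra. split; [ring|].
    rewrite <- G3 at 3. rewrite G1, Rabs_right by lra. lra. }
  assert (Hcon : forall y y', O y -> O y' -> d (G y (- t)) (G y' (- t)) <= d y y').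
  { intros y y' Hy Hy'. destruct (Hseg y Hy) as [A1 A2]. destruct (Hseg y' Hy') as [B1 B2].
    apply (segment_point_contract X d HN q); lra. }
  pose proof (countable_image_constant 0 L (fun u => d' q (G (c u) (- t)))
    (fun u => list_code (code (c u))) HL) as Const.
  cbv beta in Const. rewrite E0, E1 in Const. rewrite <- Const.
  - assert (Hz : O (b (- T))) by (unfold O; rewrite metric_refl by assumption; lra).
    destruct (Hseg _ Hz) as [A1 A2]. f_equal.
    assert (Eb : d q (b (- t)) = t) by (unfold q; rewrite Hbg, Rabs_right; lra).
    apply (segment_point_unique X d HN q (b (- T))); [lra|lra|].
    rewrite HqT, Eb, Hbg, Rabs_right; lra.
  - intros u Hu eps Heps.
    destruct (topology_coarser X d' d Hm' Hc' Hl' Hm Hgc (fun x y => iff_sym (H1 x y))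
      (G (c u) (- t)) eps Heps) as [del [Hdel Kd]].
    exists del. split; [assumption|]. intros v Hv Huv.
    rewrite (metric_sym X d' Hm' q), (metric_sym X d' Hm' q).
    eapply Rle_lt_trans; [now apply metric_lip|]. apply Kd.
    eapply Rle_lt_trans; [apply Hcon; now apply HcO|]. rewrite Hiso; assumption.
  - intros u v Hu Hv E. apply list_code_inj in E.
    destruct (Same _ _ (HcO u Hu) (HcO v Hv) E) as [C HC].
    destruct (HG _ (HcO u Hu)) as (_ & U2 & _). destruct (HG _ (HcO v Hv)) as (_ & V2 & _).
    rewrite <- U2 at 1. rewrite <- V2.
    rewrite !(metric_sym X d' Hm' (G _ 0)).
    rewrite !linked_dist by (try lra; now apply HGl, HcO).
    rewrite !HC. ring. }
destruct (HG x Hx) as (G1 & G2 & G3). destruct (HGb x Hx) as [M1 R1].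
destruct (end_transfer X d d' HN HN' H1 _ _ _ G1 Hbg M1) as [C K1].
set (h := infn (endpair X d (G x) b 0 0)) in *.
(* Equal [d']-distances on the unit segment before [b 0] make [psi b (s - h) - psi b s] constant for
   [s] in [[-1, 0]], hence everywhere by periodicity. *)
assert (Z : - h = 0).
{ apply (linked_no_translation b _ (psi X d' b (- h) - psi X d' b 0) Hb); [unfold r in *; lra|].
  intros s.
  enough (psi X d' b (s + - h) - psi X d' b s = psi X d' b (- h) - psi X d' b 0) by lra.
  revert s. apply unit_periodic_constant.
  - pose proof (proj1 (psi_unit_increasing X d d' HN HN' H1 b Hbg)) as U. intros s.
    rewrite U. replace (s + 1 + - h) with (s + - h + 1) by ring. rewrite U. ring.
  - intros s Hs. specialize (Econst (- s) ltac:(lra)). rewrite Ropp_involutive in Econst.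
    rewrite <- G2 in Econst at 1. unfold q in Econst.
    rewrite !(metric_sym X d' Hm' (_ 0)) in Econst.
    rewrite !linked_dist in Econst by (try lra; try assumption; now apply HGl).
    pose proof (K1 s) as A1. pose proof (K1 0) as A2.
    replace (s - h) with (s + - h) in A1 by ring. rewrite Rminus_0_l in A2. lra. }
destruct (infn_spec _ _ M1) as [I1 _]. fold h in I1.
(* With [h = 0], the negative half of [G x] and the positive half of [b] fit together to a line. *)
set (c := fun s => if Rlt_dec s 0 then G x s else b s).
assert (Hneg : forall s t, s <= 0 -> 0 <= t -> d (G x s) (b t) = t - s).
{ intros s t Hs Ht. apply Rle_antisym.
  - pose proof (metric_tri X d Hm q (G x s) (b t)) as Tr. rewrite <- G2 in Tr at 1.
    unfold q in Tr. rewrite G1, Hbg in Tr.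
    rewrite <- Rabs_Ropp, Rabs_right in Tr by lra.
    rewrite <- (Rabs_Ropp (0 - t)), Rabs_right in Tr by lra. lra.
  - destruct (nat_above (t - s)) as [k Hk]. specialize (I1 k). unfold endpair in I1.
    rewrite Rminus_0_l, Rplus_0_l in I1.
    pose proof (metric_tri X d Hm (G x s) (G x (- INR k)) (b (INR k))) as T1.
    pose proof (metric_tri X d Hm (b t) (G x s) (b (INR k))) as T2.
    rewrite G1, <- Rabs_Ropp, Rabs_right in T1 by lra.
    rewrite Hbg, <- Rabs_Ropp, Rabs_right in T2 by lra. lra. }
assert (Hcg : complete_geodesic d c).
{ intros s t. unfold c. destruct (Rlt_dec s 0), (Rlt_dec t 0).
  - apply G1.
  - rewrite Hneg, <- Rabs_Ropp, Rabs_right by lra. ring.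
  - rewrite metric_sym, Hneg, Rabs_right by (assumption || lra). ring.
  - apply Hbg. }
assert (Hcb : forall s, 0 <= s -> c s = b s).
{ intros s Hs. unfold c. destruct (Rlt_dec s 0); [lra|reflexivity]. }
exists c. split; [|split; [assumption|]].
- apply linked_forward with (b := b) (M := 0); try assumption.
  intros k. unfold endpair. rewrite Rminus_0_l, Rplus_0_l. pose proof (pos_INR k).
  rewrite Hcb, Hbg, <- Rabs_Ropp, Rabs_right by lra. lra.
- fold q. unfold c. rewrite (metric_sym X d Hm x q). pose proof (HO1 x Hx).
  destruct (Rlt_dec (- d q x) 0); [assumption|lra].
Qed.

End Rigidity.

(** * Countability near [a (-T)] against connectedness at infinity *)

Section Contradiction.
Variables (X : Type) (d d' : X -> X -> R).
Hypotheses (HN : nice d) (HN' : nice d')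
  (H1 : forall x y, d x y <= 1 <-> d' x y <= 1).
Variables (a : R -> X) (k0 : R) (D : list nat -> X).
Hypotheses (Ha : complete_geodesic d a) (Hk0 : 0 < k0)
  (Hper : forall tau, 0 < tau < k0 -> ~ period (psi X d' a) tau)
  (HD : forall x e, 0 < e -> exists l, d (D l) x < e).

(* The set of points from which the geodesic to [a 0] passes through [x] has nonempty
   interior, hence contains some [D l]; and [x] is determined by [l] and [d x (a 0)]. *)
Lemma shadow_code : exists T e, 1 <= T /\ 0 < e <= 1 /\
  exists code : X -> nat, forall x y, d (a (- T)) x < e -> d (a (- T)) y < e ->
    d x (a 0) = d y (a 0) -> code x = code y -> x = y.
Proof.
pose proof HN as (Hm & Hc & _).
assert (La : linked X d d' a a).
{ split; [assumption|]. exists 0, 0. intros s. now rewrite !Rplus_0_r. }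
pose proof (linked_shadow X d d' HN HN' H1 a k0 D Hk0 Hper HD) as Sh.
destruct (Sh a La) as (T & e & HT & He & K).
exists T, e. split; [assumption|]. split; [assumption|].
assert (S : forall x, exists l, d (a (- T)) x < e ->
  d (D l) (a 0) = d (D l) x + d x (a 0)).
{ intros x. destruct (classic (d (a (- T)) x < e)) as [Hx|Hx]; [|exists nil; tauto].
  destruct (K x Hx) as (c & Lc & Hca & Hcx).
  set (L := d x (a 0)) in *. pose proof (metric_pos X d Hm x (a 0)) as HL. fold L in HL.
  (* Translated by [- L], the line [c] is at [x] at time 0. A dense point in its shadow lies on a
     line that follows [c] from [x] to [a 0]. *)
  pose proof (linked_shift X d d' HN HN' H1 a c (- L) Lc) as Ls.
  destruct (Sh _ Ls) as (T2 & e2 & HT2 & He2 & K2). cbv beta in K2.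
  rewrite Rplus_0_l, Hcx in K2.
  destruct (HD (c (- T2 + - L)) e2 (proj1 He2)) as [l Hl].
  exists l. intros _. rewrite metric_sym in Hl by assumption.
  destruct (K2 _ Hl) as (c2 & [Hc2 _] & Hc2c & Hc2x).
  pose proof (Hc2 (- d (D l) x) L) as E. rewrite Hc2x, Hc2c in E by assumption.
  replace (L + - L) with 0 in E by ring. rewrite Hca in E by lra.
  pose proof (metric_pos X d Hm (D l) x).
  rewrite <- Rabs_Ropp, Rabs_right in E by lra. lra. }
destruct (choice _ S) as [f Hf].
exists (fun x => list_code (f x)). intros x y Hx Hy Exy E.
apply list_code_inj in E.
pose proof (Hf x Hx) as Fx. pose proof (Hf y Hy) as Fy. rewrite <- E in Fy.
apply (segment_point_unique X d HN (D (f x)) (a 0)); lra.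
Qed.

(** A path outside a small ball around [z = a (-T)] leads from behind [z] to its front, as seen from
    [q = a 0]. Its projection to the sphere around [z] cannot stop being behind [z]: there, nearby
    points at a fixed distance from [q] are countably many, so they cannot move continuously. *)
Lemma connected_contradiction : connected_at_infinity d -> False.
Proof.
pose proof HN as (Hm & Hc & _). intros Hconn.
destruct shadow_code as (T & e & HT & He & code & Hcode).
set (q := a 0). set (z := a (- T)). set (e2 := e / 2).
assert (Hzq : d z q = T) by (unfold z, q; rewrite Ha, <- Rabs_Ropp, Rabs_right; lra).
assert (Hzb : d z (a (- T - e2)) = e2) by (unfold z, e2; rewrite Ha, Rabs_right; lra).
assert (Hzf : d z (a (- T + e2)) = e2)
  by (unfold z, e2; rewrite Ha, <- Rabs_Ropp, Rabs_right; lra).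
destruct (Hconn z e2 (a (- T - e2)) (a (- T + e2))) as (p & [Hp1 Hp2] & E0 & E1);
  try (unfold ball; lra).
assert (S : forall u, exists w, 0 <= u <= 1 -> d z w = e2 /\ d z (p u) = e2 + d w (p u)).
{ intros u. destruct (classic (0 <= u <= 1)) as [Hu|Hu]; [|exists z; tauto].
  specialize (Hp1 u Hu). unfold ball in Hp1.
  destruct (point_at_distance X d HN z (p u) e2) as [w [W1 W2]]; [unfold e2 in *; lra|].
  exists w. intros _. lra. }
destruct (choice _ S) as [w Hw]. clear S.
assert (Hww : forall u v, 0 <= u <= 1 -> 0 <= v <= 1 -> d (w u) (w v) <= d (p u) (p v)).
{ intros u v Hu Hv. destruct (Hw u Hu). destruct (Hw v Hv).
  apply (segment_point_contract X d HN z); lra. }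
assert (Ew : forall u, 0 <= u <= 1 -> d z (p u) = e2 -> w u = p u).
{ intros u Hu E. destruct (Hw u Hu). apply (metric_eq X d Hm). lra. }
(* The times at which the projection [w u] lies behind [z], on a geodesic to [q] through [z]. Time 0
   belongs to it and time 1 does not; [s] is the last such time. *)
set (Z := fun u => 0 <= u <= 1 /\ d (w u) q = e2 + T).
assert (Z0 : Z 0).
{ split; [lra|]. rewrite Ew, E0 by (try rewrite E0; lra). unfold q.
  rewrite Ha, <- Rabs_Ropp, Rabs_right; unfold e2; lra. }
destruct (completeness Z) as [s [Hs1 Hs2]].
- exists 1. intros u [Hu _]. lra.
- now exists 0.
- assert (Hs : 0 <= s <= 1).
  { split; [now apply Hs1|]. apply Hs2. intros u [Hu _]. lra. }
  assert (Zs : d (w s) q = e2 + T).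
  { apply cond_eq. intros eps Heps. destruct (Hp2 s Hs eps Heps) as [del [Hdel Kd]].
    assert (exists u, Z u /\ s - del < u <= s) as (u & [Hu Zu] & Hus).
    { apply NNPP. intros NC. assert (s <= s - del); [|lra]. apply Hs2. intros u Hu.
      apply Rnot_lt_le. intros L. apply NC. exists u. split; [assumption|].
      split; [assumption|]. now apply Hs1. }
    rewrite <- Zu. eapply Rle_lt_trans; [now apply metric_lip|].
    eapply Rle_lt_trans; [now apply Hww|]. apply Kd; [assumption|].
    apply Rabs_def1; lra. }
  assert (Hs1' : s < 1).
  { destruct (proj2 Hs) as [|E]; [assumption|exfalso]. rewrite E in Zs.
    rewrite Ew, E1 in Zs by (try rewrite E1; lra). unfold q in Zs.
    rewrite Ha, <- Rabs_Ropp, Rabs_right in Zs; unfold e2 in *; lra. }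
  destruct (Hp2 s Hs (e2 / 4)) as [del [Hdel Kd]]; [unfold e2; lra|].
  set (u1 := Rmin 1 (s + del / 2)).
  assert (Hu1 : s < u1 <= 1 /\ u1 <= s + del / 2).
  { unfold u1. split; [split; [apply Rmin_glb_lt; lra|apply Rmin_l]|apply Rmin_r]. }
  (* The point [m s] of the segment from [q] to [w s] at this distance from [q] is the midpoint of
     [z] and [w s]. For [u] slightly after [s], [m u] stays in the ball where the code is injective
     at fixed distance from [q]. *)
  set (rho := T + e2 / 2).
  assert (Hnear : forall u, s <= u <= u1 -> d (w u) (w s) < e2 / 4).
  { intros u Hu. rewrite metric_sym by assumption.
    eapply Rle_lt_trans; [apply Hww; lra|]. apply Kd; [lra|]. apply Rabs_def1; lra. }
  assert (S : forall u, exists m, s <= u <= u1 -> d q m = rho /\ d q (w u) = rho + d m (w u)).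
  { intros u. destruct (classic (s <= u <= u1)) as [Hu|Hu]; [|exists z; tauto].
    pose proof (Hnear u Hu). pose proof (metric_tri X d Hm (w u) q (w s)) as Tr.
    rewrite (metric_sym X d Hm q (w s)) in Tr.
    destruct (point_at_distance X d HN q (w u) rho) as [m [M1 M2]];
      [unfold rho, e2 in *; lra|].
    exists m. intros _. lra. }
  destruct (choice _ S) as [m Hmm]. clear S.
  assert (Hmcon : forall u v, s <= u <= u1 -> s <= v <= u1 -> d (m u) (m v) <= d (w u) (w v)).
  { intros u v Hu Hv. destruct (Hmm u Hu). destruct (Hmm v Hv).
    apply (segment_point_contract X d HN q); lra. }
  assert (Hzm : d z (m s) = e2 / 2).
  { destruct (Hw s Hs) as [W1 _].
    destruct (point_at_distance X d HN z (w s) (e2 / 2)) as [y [Y1 Y2]]; [unfold e2 in *; lra|].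
    destruct (Hmm s ltac:(lra)) as [M1 M2].
    pose proof (metric_tri X d Hm z q y) as T1. pose proof (metric_tri X d Hm y q (w s)) as T2.
    rewrite (metric_sym X d Hm q z) in T1. rewrite (metric_sym X d Hm q (w s)) in T2.
    rewrite (segment_point_unique X d HN q (w s) (m s) y); unfold rho in *;
      rewrite ?(metric_sym X d Hm q (w s)) in *; lra. }
  assert (HmO : forall u, s <= u <= u1 -> d z (m u) < e).
  { intros u Hu. pose proof (metric_tri X d Hm (m s) z (m u)).
    pose proof (Hmcon s u ltac:(lra) Hu). pose proof (Hnear u Hu).
    rewrite (metric_sym X d Hm (w s)) in *. unfold e2 in *. lra. }
  assert (Em : m s = m u1).
  { apply (metric_eq X d Hm).
    rewrite <- (metric_refl X d Hm (m s)).
    symmetry. apply (countable_image_constant s u1 (fun u => d (m s) (m u)) (fun u => code (m u))).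
    - lra.
    - intros u Hu eps Heps. destruct (Hp2 u ltac:(lra) eps Heps) as [del2 [Hdel2 Kd2]].
      exists del2. split; [assumption|]. intros v Hv Huv.
      rewrite !(metric_sym X d Hm (m s)).
      eapply Rle_lt_trans; [now apply metric_lip|].
      eapply Rle_lt_trans; [now apply Hmcon|].
      eapply Rle_lt_trans; [apply Hww; lra|].
      apply Kd2; [lra|]. now rewrite Rabs_minus_sym.
    - intros u v Hu Hv E. f_equal. apply Hcode; try assumption; try now apply HmO.
      rewrite !(metric_sym X d Hm _ (a 0)). fold q.
      destruct (Hmm u Hu) as [-> _]. now destruct (Hmm v Hv) as [-> _]. }
  (* Since [m u1 = m s] is at distance [e2 / 2] from [z], the point [w u1] is at least [e2 / 2]
     beyond it, hence behind [z], contrary to the choice of [s]. *)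
  assert (Zu1 : Z u1).
  { split; [lra|]. destruct (Hw u1 ltac:(lra)) as [W1 _].
    destruct (Hmm u1 ltac:(lra)) as [M1 M2]. rewrite <- Em in M1, M2.
    pose proof (metric_tri X d Hm (m s) z (w u1)) as T1.
    pose proof (metric_tri X d Hm z q (w u1)) as T2.
    rewrite (metric_sym X d Hm q z) in T2. rewrite (metric_sym X d Hm (w u1) q).
    unfold rho in *. lra. }
  apply Hs1 in Zu1. lra.
Qed.

End Contradiction.

Lemma psi_identity (X : Type) (d d' : X -> X -> R) a s : nice d -> nice d' ->
  (forall x y, d x y <= 1 <-> d' x y <= 1) -> connected_at_infinity d ->
  complete_geodesic d a -> psi X d' a s = s.
Proof.
intros HN HN' H1 Hconn Ha. pose proof HN as (Hm & Hc & Hl & _).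
destruct (separable X d Hm (a 0) Hl (proj1 Hc)) as [D HD].
apply small_periods_identity.
- now apply (psi_unit_increasing X d d').
- apply psi_zero; [apply HN'|]. now apply (geodesic_pgeod_transfer X d d').
- intros k Hk. apply NNPP. intros C.
  apply (connected_contradiction X d d' HN HN' H1 a k D Ha Hk); try assumption.
  intros tau Ht Hp. apply C. now exists tau.
Qed.

(** * Transfer of asymptotic chains *)

(** Lines of different metrics that agree at integers stay within distance 3: from time [t] to the
    next integer, [c] moves by at most 1, and [c'] by at most 1 for [d'], so at most 2 for [d]. *)
Lemma finite_hausdorff_line (X : Type) (d d' : X -> X -> R) c c' R' : is_metric d ->
  (forall x y, d x y <= d' x y + 1) ->
  complete_geodesic d c -> complete_geodesic d' c' -> (forall i, c (IZR i) = c' (IZR i)) ->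
  ray_of c' R' -> exists R0, ray_of c R0 /\ finite_hausdorff d R0 R'.
Proof.
intros Hm Hdd Hc Hc' Hi [t0 Hr].
assert (Hcc : forall t, d (c t) (c' t) <= 3).
{ intros t. destruct (archimed t) as [A B].
  pose proof (metric_tri X d Hm (c (IZR (up t))) (c t) (c' t)) as T1.
  rewrite Hc, Hi in T1. pose proof (Hdd (c' (IZR (up t))) (c' t)) as T2. rewrite Hc' in T2.
  rewrite <- Rabs_Ropp, Rabs_right in T1 by lra. rewrite Rabs_right in T2 by lra. lra. }
destruct Hr as [Hr|Hr].
- exists (fun p => exists t, t0 <= t /\ p = c t). split.
  + exists t0. left. tauto.
  + exists 3. split.
    * intros p (t & Ht & ->). exists (c' t). split; [|apply Hcc]. apply Hr. now exists t.
    * intros p Hp. apply Hr in Hp as (t & Ht & ->). exists (c t). split; [now exists t|apply Hcc].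
- exists (fun p => exists t, t <= t0 /\ p = c t). split.
  + exists t0. right. tauto.
  + exists 3. split.
    * intros p (t & Ht & ->). exists (c' t). split; [|apply Hcc]. apply Hr. now exists t.
    * intros p Hp. apply Hr in Hp as (t & Ht & ->). exists (c t). split; [now exists t|apply Hcc].
Qed.

Section Chains.
Variables (X : Type) (d d' : X -> X -> R).
Hypotheses (HN : nice d) (HN' : nice d')
  (H1 : forall x y, d x y <= 1 <-> d' x y <= 1).

Lemma asymptotic_transfer b' c' b c :
  complete_geodesic d b -> complete_geodesic d' b' -> (forall i, b (IZR i) = b' (IZR i)) ->
  complete_geodesic d c -> complete_geodesic d' c' -> (forall i, c (IZR i) = c' (IZR i)) ->
  asymptotic d' b' c' -> asymptotic d b c.
Proof.
pose proof HN as (Hm & _). pose proof HN' as (Hm' & Hc' & _).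
intros Hb Hb' Hbi Hcc Hcc' Hci (R1 & R2 & Hr1 & Hr2 & C & HC1 & HC2).
assert (Hdd : forall x y, d x y <= d' x y + 1).
{ apply dist_diff_le; try assumption. intros; now rewrite H1. }
destruct (finite_hausdorff_line X d d' b b' R1 Hm Hdd Hb Hb' Hbi Hr1) as (S1 & A1 & C1 & B1 & B1').
destruct (finite_hausdorff_line X d d' c c' R2 Hm Hdd Hcc Hcc' Hci Hr2) as (S2 & A2 & C2 & B2 & B2').
exists S1, S2. split; [assumption|]. split; [assumption|].
exists (C1 + (C + 1) + C2). split.
- intros p Hp. destruct (B1 p Hp) as (p1 & P1 & L1). destruct (HC1 p1 P1) as (p2 & P2 & L2).
  destruct (B2' p2 P2) as (p3 & P3 & L3). exists p3. split; [assumption|].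
  pose proof (metric_tri X d Hm p1 p p3). pose proof (metric_tri X d Hm p2 p1 p3).
  pose proof (Hdd p1 p2). rewrite (metric_sym X d Hm p3 p2) in L3. lra.
- intros p Hp. destruct (B2 p Hp) as (p1 & P1 & L1). destruct (HC2 p1 P1) as (p2 & P2 & L2).
  destruct (B1' p2 P2) as (p3 & P3 & L3). exists p3. split; [assumption|].
  pose proof (metric_tri X d Hm p1 p3 p). pose proof (metric_tri X d Hm p2 p3 p1).
  pose proof (Hdd p2 p1). rewrite (metric_sym X d Hm p p1) in L1. lra.
Qed.

Lemma asym_chain_complete b c : asym_chain d' b c -> complete_geodesic d' b /\ complete_geodesic d' c.
Proof. induction 1; tauto. Qed.

(** Each [d']-line of the chain is replaced by a [d]-line through its integer points, which stays at
    bounded distance from it. *)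
Lemma asym_chain_transfer b' c' : asym_chain d' b' c' ->
  forall b, complete_geodesic d b -> (forall i, b (IZR i) = b' (IZR i)) ->
  exists c, complete_geodesic d c /\ (forall i, c (IZR i) = c' (IZR i)) /\ asym_chain d b c.
Proof.
pose proof HN as (Hm & Hc & _).
induction 1 as [c' Hc'|c1' c2' c3' Hc1' Has Hch IH]; intros b Hb Hbi.
- exists b. split; [assumption|]. split; [assumption|]. now constructor.
- pose proof (proj1 (asym_chain_complete _ _ Hch)) as Hc2'.
  pose proof (geodesic_pgeod_transfer X d' d HN' HN (fun x y => iff_sym (H1 x y)) _ Hc2') as Hp.
  destruct (line_through_integers X d c2' Hm (proj1 Hc) (proj1 Hp)) as (c2 & Hc2 & Hc2i).
  destruct (IH c2 Hc2 Hc2i) as (c3 & Hc3 & Hc3i & Hch3).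
  exists c3. split; [assumption|]. split; [assumption|].
  apply chain_step with c2; [assumption| |assumption].
  now apply (asymptotic_transfer c1' c2').
Qed.

(** A point [g] of the opposite boundary line is flat for [d'], hence for [d]. Were [b] without flat
    points off it, [g] would be [b 0], although the width is positive. *)
Lemma strip_transfer b b' : complete_geodesic d b -> complete_geodesic d' b' ->
  (forall i, b (IZR i) = b' (IZR i)) -> boundary_line_of_strip d' b' ->
  boundary_line_of_strip d b.
Proof.
pose proof HN as (Hm & Hc & _). pose proof HN' as (Hm' & Hc' & _).
intros Hb Hb' Hi (w & F & Hw & HF & Hbd). apply strip_boundary; try assumption. intros Hff.
assert (exists g, forall t, d' g (b' t) ^ 2 = (0 - t) ^ 2 + w ^ 2) as [g Hg].
{ assert (Sq : forall x1 y1 x2 y2, 0 <= y1 <= w -> 0 <= y2 <= w ->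
    d' (F x1 y1) (F x2 y2) ^ 2 = (x1 - x2) ^ 2 + (y1 - y2) ^ 2).
  { intros x1 y1 x2 y2 Hy1 Hy2. rewrite HF by assumption. apply pow2_sqrt.
    pose proof (pow2_ge_0 (x1 - x2)). pose proof (pow2_ge_0 (y1 - y2)). lra. }
  assert (Opp : forall y y', 0 <= y <= w -> 0 <= y' <= w -> (y' - y) ^ 2 = w ^ 2 ->
    (forall p, (exists t, p = b' t) <-> (exists s, p = F s y)) ->
    exists g, forall t, d' g (b' t) ^ 2 = (0 - t) ^ 2 + w ^ 2).
  { intros y y' Hy Hy' Eyy Hp.
    destruct (proj1 (Hp (b' 0)) (ex_intro _ 0 eq_refl)) as [s0 E0].
    exists (F s0 y'). intros t.
    destruct (proj1 (Hp (b' t)) (ex_intro _ t eq_refl)) as [s Es].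
    rewrite Es, Sq, Eyy by assumption.
    assert (K : d' (b' 0) (b' t) ^ 2 = (s0 - s) ^ 2).
    { rewrite E0, Es, Sq by assumption. ring. }
    rewrite Hb', pow2_abs in K. rewrite K. ring. }
  destruct Hbd as [Hbd|Hbd]; [apply (Opp 0 w)|apply (Opp w 0)]; try assumption; try lra; ring. }
assert (E1 : bus X d' b g = 0).
{ rewrite (bus_ext X d' b b') by (intros n; rewrite INR_IZR_INZ; apply Hi).
  rewrite (bus_of_pythagoras X d' Hm' b' g 0 w Hb' Hg). ring. }
assert (E2 : bus X d' (reversed b) g = 0).
{ rewrite (bus_ext X d' (reversed b) (reversed b'))
    by (intros n; unfold reversed; rewrite INR_IZR_INZ, <- opp_IZR; apply Hi).
  rewrite (bus_of_pythagoras X d' Hm' (reversed b') g 0 w); [ring| |].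
  - now apply complete_geodesic_rev.
  - intros s. unfold reversed. rewrite Hg. ring. }
destruct (Hff g) as [s Es].
{ apply (flat_transfer X d d' HN HN' H1 b g Hb). unfold flat. rewrite E1, E2. ring. }
assert (psi X d' b s = psi X d' b 0) as K.
{ rewrite psi_zero by (try assumption; now apply (geodesic_pgeod_transfer X d d')).
  unfold psi. rewrite <- Es, E1. ring. }
apply (psi_inj X d d' HN HN' H1) in K; [|assumption].
specialize (Hg 0). rewrite Es, K, <- (Hi 0%Z), metric_refl in Hg by assumption. nra.
Qed.

End Chains.

(** * Rigidity of strictly rank one geodesics *)

Theorem theorem12 (X : Type) (d d' : X -> X -> R) :
  is_metric d -> locally_compact d -> geodesically_complete d -> CAT0 d ->
  connected_at_infinity d ->
  is_metric d' -> locally_compact d' -> geodesically_complete d' -> CAT0 d' ->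
  (forall x y, d x y <= 1 <-> d' x y <= 1) ->
  forall a : R -> X, strictly_rank_one d a ->
    strictly_rank_one d' a /\
    (forall t1 t2, d' (a t1) (a t2) = d (a t1) (a t2)).
Proof.
intros Hm Hl Hgc Hc Hconn Hm' Hl' Hgc' Hc' H1 a [Ha Hro].
assert (HN : nice d) by (repeat split; assumption || apply Hm || apply Hc || apply Hgc).
assert (HN' : nice d') by (repeat split; assumption || apply Hm' || apply Hc' || apply Hgc').
assert (Hff : flat_free d a).
{ apply NNPP. intros C. apply Hro. exists a. split; [now constructor|].
  now apply strip_boundary. }
assert (Hiso : forall t1 t2, d' (a t1) (a t2) = d (a t1) (a t2)).
{ intros t1 t2. rewrite (flat_free_dist X d d' HN HN' H1) by assumption.
  now rewrite !(psi_identity X d d'), Ha. }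
assert (Ha' : complete_geodesic d' a) by (intros s t; rewrite Hiso; apply Ha).
split; [|assumption]. split; [assumption|].
intros (b' & Hch & Hst). apply Hro.
(* As [a] is a line for both metrics, the transferred chain starts with [a] itself. *)
destruct (asym_chain_transfer X d d' HN HN' H1 a b' Hch a Ha) as (b & Hb & Hbi & Hab);
  [reflexivity|].
exists b. split; [assumption|].
apply (strip_transfer X d d' HN HN' H1 b b'); try assumption.
now apply (asym_chain_complete X d' a b').
Qed.
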